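(* For each $n$ let $a^{(n)}=(a^{(n)}_{ij})_{1\le i,j\le n}$ be an array of integers, let $\rho$ be a uniformly random permutation of $\{1,\dots,n\}$, and let $W=W_n:=\sum_{i=1}^n a^{(n)}_{i\rho_i}$. Write $\sigma^2=(\sigma^{(n)})^2:=\mathrm{Var}(W_n)$. Suppose that there are positive constants $A_1,\alpha_0,\alpha_1,\alpha_2$, not depending on $n$, such that the following two assumptions hold for all $n$. (A1) $\max_{1\le i,j\le n}|a^{(n)}_{ij}|\le A_1<\infty$ and $n^{-1}(\sigma^{(n)})^2\ge(\alpha_0A_1)^2>0$. (A2) There exists a set $\mathcal{I}=\{\{i_{l1},i_{l2}\}:1\le l\le n_1\}$ of $n_1\ge\alpha_1n$ disjoint pairs of indices in $\{1,\dots,n\}$ such that, for each $\{i_1,i_2\}\in\mathcal{I}$, there exists a set $\mathcal{J}(i_1,i_2)$ of $n_2\ge\alpha_2n^2$ (not necessarily disjoint) pairs of indices $\{j_1,j_2\}$ such that $$\bigl|a^{(n)}_{i_1,j_1}+a^{(n)}_{i_2,j_2}-a^{(n)}_{i_1,j_2}-a^{(n)}_{i_2,j_1}\bigr|=1 .$$ Then, as $n\to\infty$, $$d_{\mathrm{TV}}\bigl(\mathcal{L}(W),\mathrm{TP}(\mathbb{E}W,\mathrm{Var}(W))\bigr)=O(\sigma^{-1}),\qquad d_{\mathrm{loc}}\bigl(\mathcal{L}(W),\mathrm{TP}(\mathbb{E}W,\mathrm{Var}(W))\bigr)=O\Bigl(\frac{\sqrt{\log(\sigma)}}{\sigma^2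}\Bigr).$$
   Context: Translated Poisson distribution: $Z\sim\mathrm{TP}(\mu,\sigma^2)$ means that $Z-s$ has the Poisson distribution with mean $\sigma^2+\gamma$, where $s:=\lfloor\mu-\sigma^2\rfloor$ and $\gamma:=\mu-\sigma^2-\lfloor\mu-\sigma^2\rfloor$. Metrics for integer valued $X,Y$: $d_{\mathrm{TV}}(\mathcal{L}(X),\mathcal{L}(Y)):=\sup_{A\subseteq\mathbb{Z}}|\mathbb{P}[X\in A]-\mathbb{P}[Y\in A]|$ and $d_{\mathrm{loc}}(\mathcal{L}(X),\mathcal{L}(Y)):=\sup_{a\in\mathbb{Z}}|\mathbb{P}[X=a]-\mathbb{P}[Y=a]|$. Pairs are unordered pairs of two distinct indices in $\{1,\dots,n\}$. *)

(* Defs.v *)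
From HB Require Import structures.
From mathcomp Require Import all_boot all_order all_algebra all_fingroup.
From mathcomp Require Import all_classical all_reals all_analysis.
Set Implicit Arguments.
Unset Strict Implicit.
Unset Printing Implicit Defensive.
Import Order.TTheory GRing.Theory Num.Theory.
Import numFieldNormedType.Exports.
Local Open Scope classical_set_scope.
Local Open Scope ring_scope.

(* The integers carry the discrete sigma-algebra, as [nat] does in the
   library. *)
HB.instance Definition _ := isPointed.Build int 0.
HB.instance Definition _ := @isMeasurable.Build default_measure_display
  int discrete_measurable discrete_measurable0
  discrete_measurableC discrete_measurableU.

(* Laws of integer-valued random variables are functions [set int -> \bar R].
   Both suprema below are over nonempty sets of reals, bounded by 1 when the
   arguments are probabilities. *)
Definition dTV (R : realType) (mu nu : set int -> \bar R) : R :=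
  sup [set `|fine (mu A) - fine (nu A)| | A in [set: set int]].

Definition dloc (R : realType) (mu nu : set int -> \bar R) : R :=
  sup [set `|fine (mu [set k]) - fine (nu [set k])| | k in [set: int]].

(* The law of [s + N] with [N] Poisson of mean [sigma2 + gamma].  The second
   argument of [poisson_prob] is not used in its definition. *)
Definition translated_poisson (R : realType) (mu sigma2 : R) :
    set int -> \bar R :=
  let s : int := Num.floor (mu - sigma2) in
  let gamma : R := mu - sigma2 - s%:~R in
  pushforward (poisson_prob (sigma2 + gamma) 0) (fun k : nat => s + k%:Z).

Definition uniform_permutation (R : realType) (d : measure_display)
    (T : measurableType d) (P : probability T R) (n : nat) (rho : T -> 'S_n) :=
  forall s : 'S_n, measurable (rho @^-1` [set s]) /\
    P (rho @^-1` [set s]) = (n`!%:R^-1)%:E.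

Definition perm_sum (n : nat) (a : 'M[int]_n) (s : 'S_n) : int :=
  \sum_(i < n) a i (s i).

Section IntegerValued.
Context (R : realType) (d : measure_display) (T : measurableType d).
Context (P : probability T R) (X : T -> int).

Definition law : set int -> \bar R := pushforward P X.
Definition mean : R := fine ('E_P[fun w => (X w)%:~R])%E.
Definition var : R := fine ('V_P[fun w => (X w)%:~R])%E.

End IntegerValued.

Definition assumption1 (R : realType) (n : nat) (a : 'M[int]_n) (sigma2 : R)
    (A1 alpha0 : R) : Prop :=
  (forall i j : 'I_n, `|a i j|%:~R <= A1) /\
  (alpha0 * A1) ^+ 2 <= n%:R^-1 * sigma2.

Definition pairs (n : nat) : {set {set 'I_n}} :=
  [set e : {set 'I_n} | #|e| == 2%N]%SET.

(* [finset.trivIset I]: the pairs in [I] are pairwise disjoint. *)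
Definition assumption2 (R : realType) (n : nat) (a : 'M[int]_n)
    (alpha1 alpha2 : R) : Prop :=
  exists I : {set {set 'I_n}},
    [/\ I \subset pairs n, finset.trivIset I, alpha1 * n%:R <= #|I|%:R &
      forall i1 i2 : 'I_n, [set i1; i2]%SET \in I ->
        exists J : {set {set 'I_n}},
          [/\ J \subset pairs n, alpha2 * n%:R ^+ 2 <= #|J|%:R &
            forall j1 j2 : 'I_n, [set j1; j2]%SET \in J ->
              `|a i1 j1 + a i2 j2 - a i1 j2 - a i2 j1| = 1]].

(* Main.v *)
(* Stein's method for the Poisson law shifted by an integer.  If the solution [g] of
   the Stein-Chen equation for a set is evaluated at [W], the exchangeable pair
   obtained by composing the permutation with a random transposition turns
   E[(W - mu) g(W)] into sigma^2 E[g(W + 1) - g(W)] up to O(n) terms of the form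
   E[psi (D^2 g)(W + m)], where [D^2 g] is the second difference of [g] and
   [psi] depends on the permutation at no more than four points.  Each such
   term is small: swapping the two values at a pair of [I] moves [W] by +-1
   with frequency bounded below, and averaging over these independent swaps
   (N of them, with E[1/(N+1)] = O(1/n)) applies N times the operator
   (h(m) + h(m+1))/2 to [D^2 g], which gains a factor N^-1/2 per difference.
   Both |g(m+1) - g(m)| <= 1/lambda (any set) and |g| <= 1/lambda (a single
   point) hold, so spending one difference gives the total variation bound and
   spending two gives a local bound O(1/sigma^2). *)
Require Import Defs.
From mathcomp Require Import all_boot all_order all_algebra all_fingroup.
From mathcomp Require Import all_classical all_reals all_analysis.
From mathcomp Require Import ring lra zify.
Import Order.TTheory GRing.Theory Num.Theory.
Import numFieldNormedType.Exports.
Local Open Scope ring_scope.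
Set Implicit Arguments.
Unset Strict Implicit.
Unset Printing Implicit Defensive.

(** * Averaging over independent steps *)

Section Averaging.
Context {R : realType}.
Implicit Types (F G H h : int -> R) (d w m : int) (a c : R).

Definition fdiff h m : R := h (m + 1) - h m.
Definition avg d H m : R := (H m + H (m + d)) / 2.
(** [avgn n H m] is E[H(m + Y)] with Y binomial (n, 1/2). *)
Definition avgn n := iter n (avg 1).
Arguments avgn : simpl never.
Definition avgs (ds : seq int) H := foldr avg H ds.

Lemma avgC d e H : avg d (avg e H) = avg e (avg d H).
Proof. by apply/funext => m; rewrite /avg (addrAC m e d); ring. Qed.

Lemma avgnS n H : avgn n.+1 H = avg 1 (avgn n H).
Proof. by []. Qed.

Lemma avgn_avg n d H : avgn n (avg d H) = avg d (avgn n H).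
Proof. by elim: n => // n IH; rewrite !avgnS IH avgC. Qed.

Lemma avgnD p n H : avgn (p + n) H = avgn p (avgn n H).
Proof. by rewrite /avgn iterD. Qed.

Lemma avgn_diff n h : avgn n (fdiff h) = fdiff (avgn n h).
Proof.
elim: n => // n IH; rewrite !avgnS IH; apply/funext => m.
by rewrite /avg /fdiff; ring.
Qed.

Lemma avg_bound d H c : (forall m, `|H m| <= c) -> forall m, `|avg d H m| <= c.
Proof.
move=> Hc m; rewrite /avg normrM [`|2^-1|]ger0_norm ?invr_ge0//.
rewrite ler_pdivrMr// mulr_natr mulr2n; apply: le_trans (ler_normD _ _) _.
exact: lerD.
Qed.

Lemma avgn_bound n H c :
  (forall m, `|H m| <= c) -> forall m, `|avgn n H m| <= c.
Proof. by move=> Hc; elim: n => // n IH; rewrite avgnS; apply: avg_bound. Qed.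

Lemma avgn_ler n F G :
  (forall m, `|F m| <= G m) -> forall m, `|avgn n F m| <= avgn n G m.
Proof.
move=> FG; elim: n => // n IH m; rewrite !avgnS /avg.
rewrite normrM [`|2^-1|]ger0_norm ?invr_ge0//.
rewrite ler_wpM2r ?invr_ge0//; apply: le_trans (ler_normD _ _) _; exact: lerD.
Qed.

Lemma avgnDf n F G m :
  avgn n (fun k => F k + G k) m = avgn n F m + avgn n G m.
Proof.
by elim: n m => // n IH m; rewrite !avgnS /avg !IH; ring.
Qed.

Lemma avgnZ n a F m : avgn n (fun k => a * F k) m = a * avgn n F m.
Proof.
by elim: n m => // n IH m; rewrite !avgnS /avg !IH; ring.
Qed.

Lemma avgn_cst n a m : avgn n (fun=> a) m = a.
Proof. by elim: n m => // n IH m; rewrite !avgnS /avg !IH; lra. Qed.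

(** With Y binomial (n, 1/2), 2Y - n has mean zero and variance n. *)
Lemma avgn_sqr n w m :
  avgn n (fun k => ((2 * (k - w))%:~R - n%:R) ^+ 2) m
  = (2 * (m - w))%:~R ^+ 2 + n%:R :> R.
Proof.
(* The centring depends on [n]; a free constant [c] detaches it from the induction. *)
suff E c : avgn n (fun k => ((2 * (k - w))%:~R + c) ^+ 2) m
  = ((2 * (m - w))%:~R + c + n%:R) ^+ 2 + n%:R :> R by rewrite E; ring.
elim: n c m => [|n IH] c m; first by rewrite /avgn /= !addr0.
rewrite avgnS /avg !IH -[n.+1%:R]natr1 !(rmorphM, rmorphB, rmorphD) /=.
by field.
Qed.

(* Summation by parts: with [Y] binomial (n, 1/2), this reads
   E[(2Y - n) h(w + Y)] = n/2 E[fdiff h (w + Y')], Y' binomial (n - 1, 1/2). *)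
Lemma avgn_centered n h w :
  avgn n.+1 (fun k => ((2 * (k - w))%:~R - n.+1%:R) * h k) w
  = n.+1%:R / 2 * avgn n (fdiff h) w.
Proof.
elim: n w => [|n IH] w.
  rewrite /avgn /= /avg /fdiff subrr mulr0 addrAC subrr add0r; ring.
rewrite {1}avgnS {1}/avg.
have -> : (fun k => ((2 * (k - w))%:~R - n.+2%:R) * h k) =
    (fun k => ((2 * (k - w))%:~R - n.+1%:R) * h k + -1 * h k).
  by apply/funext => k; rewrite -[in LHS]natr1; ring.
(* Against the centring of the induction hypothesis, the excess is [- h] seen from [w] and [+ h]
   seen from [w + 1]; together they give the missing half difference. *)
have E : (fun k => ((2 * (k - w))%:~R - n.+1%:R) * h k + -1 * h k) =
    (fun k => ((2 * (k - (w + 1)))%:~R - n.+1%:R) * h k + 1 * h k).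
  by apply/funext => k; rewrite !(rmorphM, rmorphB, rmorphD) /=; ring.
rewrite [X in (_ + X) / 2](_ : _ = avgn n.+1 (fun k =>
  ((2 * (k - (w + 1)))%:~R - n.+1%:R) * h k + 1 * h k) (w + 1)); last by rewrite -E.
have /= -> := avgnDf n.+1 (fun k => ((2 * (k - w))%:~R - n.+1%:R) * h k)
  (fun k => -1 * h k) w.
have /= -> := avgnDf n.+1 (fun k => ((2 * (k - (w + 1)))%:~R - n.+1%:R) * h k)
  (fun k => 1 * h k) (w + 1).
rewrite !IH !avgnZ.
have E1 : avgn n.+1 (fdiff h) w = (avgn n (fdiff h) w + avgn n (fdiff h) (w + 1)) / 2.
  by [].
have E2 : avgn n.+1 (fdiff h) w = avgn n.+1 h (w + 1) - avgn n.+1 h w.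
  by rewrite avgn_diff.
have -> : n.+2%:R / 2 * avgn n.+1 (fdiff h) w =
    n.+1%:R / 2 * avgn n.+1 (fdiff h) w + avgn n.+1 (fdiff h) w / 2.
  by rewrite -[n.+2%:R]natr1; ring.
by rewrite {1}E1 E2; ring.
Qed.

(** Summation by parts trades the difference for the factor 2Y - (n + 1), Y binomial (n + 1, 1/2),
    whose standard deviation is sqrt(n + 1). *)
Lemma avgn_diff_bound n h c : (forall m, `|h m| <= c) ->
  forall m, `|avgn n (fdiff h) m| <= 2 * c / Num.sqrt n.+1%:R.
Proof.
move=> hc m.
have -> : avgn n (fdiff h) m = 2 / n.+1%:R *
    avgn n.+1 (fun k => ((2 * (k - m))%:~R - n.+1%:R) * h k) m.
  by rewrite avgn_centered; field; rewrite nat1r pnatr_eq0.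
set s := Num.sqrt _.
have s0 : 0 < s by rewrite sqrtr_gt0 ltr0n.
have sE : s ^+ 2 = n.+1%:R by rewrite sqr_sqrtr.
have c0 : 0 <= c by apply: le_trans (hc 0).
(* The pointwise bound |x| <= (s^2 + x^2) / (2 s) stands in for Cauchy-Schwarz, so the second moment
   suffices. *)
have := @avgn_ler n.+1 (fun k => ((2 * (k - m))%:~R - n.+1%:R) * h k)
  (fun k => c / (2 * s) * (s ^+ 2 + ((2 * (k - m))%:~R - n.+1%:R) ^+ 2)) _ m.
rewrite avgnZ avgnDf avgn_cst avgn_sqr subrr mulr0 expr0n add0r -sE => bd.
rewrite normrM ger0_norm ?divr_ge0 ?sqr_ge0//.
have -> : 2 * c / s = 2 / s ^+ 2 * (c / (2 * s) * (s ^+ 2 + s ^+ 2)).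
  by field; rewrite gt_eqF.
apply: ler_wpM2l; first by rewrite divr_ge0 ?exprn_ge0// ltW.
apply: bd => k; rewrite normrM mulrC.
apply: (@le_trans _ _ (c * `|(2 * (k - m))%:~R - s ^+ 2|)).
  by rewrite ler_wpM2r.
rewrite -mulrA ler_wpM2l// -[(_ - s^+2)^+2]real_normK ?num_real//.
rewrite [leRHS]mulrC ler_pdivlMr ?mulr_gt0//.
by set x := `|_|; have := sqr_ge0 (s - x); lra.
Qed.

(** Each half of the [n] averages absorbs one of the two differences; for odd [n] the average left
    over is a contraction. *)
Lemma avgn_diff2_bound n h c : (forall m, `|h m| <= c) ->
  forall m, `|avgn n (fdiff (fdiff h)) m| <= 8 * c / n.+1%:R.
Proof.
move=> hc.
have c0 : 0 <= c by apply: le_trans (hc 0).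
set p := n./2; set s := Num.sqrt (p.+1%:R : R).
have s0 : 0 < s by rewrite sqrtr_gt0 ltr0n.
have sE : s ^+ 2 = p.+1%:R by rewrite sqr_sqrtr.
have B : forall m, `|avgn (p + p) (fdiff (fdiff h)) m| <= 2 * (2 * c / s) / s.
  rewrite avgnD [avgn p (fdiff (fdiff h))]avgn_diff; apply: avgn_diff_bound.
  exact: avgn_diff_bound.
have -> : n = (odd n + (p + p))%N by rewrite addnn odd_double_half.
rewrite avgnD => m; apply: le_trans (avgn_bound _ B m) _.
have -> : 2 * (2 * c / s) / s = 4 * c / s ^+ 2 by field; rewrite gt_eqF.
rewrite sE ler_pdivrMr ?ltr0n// mulrAC ler_pdivlMr ?ltr0n//.
have -> : 8 * c * p.+1%:R = 4 * c * (2 * p.+1%:R) by ring.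
apply: ler_wpM2l; first by rewrite mulr_ge0.
by rewrite -natrM ler_nat; case: (odd n); lia.
Qed.

(* Only the steps of size one smooth; the other averages are contractions. *)
Lemma avgs_bound ds H c :
  (forall m, `|avgn (count (fun d => `|d| == 1) ds) H m| <= c) ->
  forall m, `|avgs ds H m| <= c.
Proof.
have avgs_avg e ds' G : avgs ds' (avg e G) = avg e (avgs ds' G).
  by elim: ds' => //= d' ds' IH; rewrite IH avgC.
elim: ds H => //= d ds IH H; case: eqP => [d1|_] /= Hc; last first.
  by apply: avg_bound; apply: IH.
rewrite -avgs_avg; apply: IH => m; rewrite avgn_avg.
have /orP[/eqP->|/eqP->] : (d == 1) || (d == -1) by lia.
  exact: Hc.
(* A step of -1 from [m] averages the same two values as a step of +1 from [m - 1]. *)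
have := Hc (m - 1); rewrite add1n avgnS /avg subrK.
by rewrite [X in `|X / _|]addrC.
Qed.

End Averaging.

(** * Means over the symmetric group *)

Lemma card_set4 (n : nat) (i j k l : 'I_n) : (#|[set i; j; k; l]| <= 4)%N.
Proof. by rewrite !cardsU !cards1; lia. Qed.

Section PermutationMean.
Context {R : realType} {n : nat}.
Implicit Types (F G : 'S_n -> R) (s t : 'S_n) (S e : {set 'I_n}).

Definition pmean F : R := n`!%:R^-1 * \sum_(s : 'S_n) F s.

Let fact_neq0 : n`!%:R != 0 :> R.
Proof. by rewrite pnatr_eq0 -lt0n fact_gt0. Qed.

Lemma eq_pmean F G : F =1 G -> pmean F = pmean G.
Proof. by move=> FG; rewrite /pmean (eq_bigr G). Qed.

Lemma pmean_cst c : pmean (fun=> c) = c.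
Proof.
by rewrite /pmean sumr_const -[c *+ _]mulr_natr mulrCA card_Sn mulVf ?mulr1.
Qed.

Lemma pmeanD F G : pmean (fun s => F s + G s) = pmean F + pmean G.
Proof. by rewrite /pmean big_split mulrDr. Qed.

Lemma pmeanZ c F : pmean (fun s => c * F s) = c * pmean F.
Proof. by rewrite /pmean -mulr_sumr mulrCA. Qed.

Lemma pmeanZr c F : pmean (fun s => F s * c) = pmean F * c.
Proof. by rewrite /pmean -mulr_suml mulrA. Qed.

Lemma pmeanN F : pmean (fun s => - F s) = - pmean F.
Proof. by rewrite /pmean sumrN mulrN. Qed.

Lemma pmeanB F G : pmean (fun s => F s - G s) = pmean F - pmean G.
Proof. by rewrite pmeanD pmeanN. Qed.

Lemma pmean_sum (I : Type) (r : seq I) (P : pred I) (F : I -> 'S_n -> R) :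
  pmean (fun s => \sum_(i <- r | P i) F i s) = \sum_(i <- r | P i) pmean (F i).
Proof. by rewrite /pmean exchange_big mulr_sumr. Qed.

Lemma ler_pmean F G : (forall s, F s <= G s) -> pmean F <= pmean G.
Proof.
by move=> FG; rewrite /pmean ler_wpM2l ?invr_ge0// ler_sum.
Qed.

Lemma pmean_ge0 F : (forall s, 0 <= F s) -> 0 <= pmean F.
Proof. by move=> F0; rewrite -(pmean_cst 0); apply: ler_pmean. Qed.

Lemma ler_norm_pmean F : `|pmean F| <= pmean (fun s => `|F s|).
Proof.
rewrite /pmean normrM ger0_norm ?invr_ge0// ler_wpM2l ?invr_ge0//.
exact: ler_norm_sum.
Qed.

Lemma pmean_mull t F : pmean (fun s => F (t * s)%g) = pmean F.
Proof. by rewrite /pmean [in RHS](reindex_inj (mulgI t)). Qed.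

Lemma pmean_mulr t F : pmean (fun s => F (s * t)%g) = pmean F.
Proof. by rewrite /pmean [in RHS](reindex_inj (mulIg t)). Qed.

Lemma pmean_exchange (F : 'S_n -> 'S_n -> R) :
  pmean (fun s => pmean (F s)) = pmean (fun t => pmean (fun s => F s t)).
Proof. by rewrite /pmean -!mulr_sumr exchange_big. Qed.

(** The second transposition sends the current image of [j] to [j']. If [i != j] and [i' != j'] it
    fixes [i'], so [i] goes to [i'] and [j] to [j'] while at most four points move. *)
Definition pairperm (i j i' j' : 'I_n) : 'S_n :=
  (tperm i i' * tperm (tperm i i' j) j')%g.

Lemma pairperm_on i j i' j' : perm_on [set i; j; i'; j'] (pairperm i j i' j').
Proof.
have tp (x y : 'I_n) (A : {set 'I_n}) : x \in A -> y \in A -> perm_on A (tperm x y).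
  move=> xA yA; apply/fintype.subsetP => z; rewrite inE.
  by case: tpermP => [->|->|]//; rewrite eqxx.
apply: perm_onM; apply: tp; rewrite ?inE ?eqxx ?orbT//.
by case: tpermP => *; rewrite ?eqxx ?orbT//; apply/eqP.
Qed.

Lemma pairpermL i j i' j' : i != j -> i' != j' -> pairperm i j i' j' i = i'.
Proof.
move=> ij ij'; rewrite permM tpermL [LHS]tpermD// 1?(eq_sym j')//.
by rewrite -[X in _ == X](tpermL i i') (inj_eq perm_inj) eq_sym.
Qed.

Lemma pairpermR i j i' j' : pairperm i j i' j' j = j'.
Proof. by rewrite permM tpermL. Qed.

(* Replace [rho] by [rho] moved at two positions so that it agrees there with
   an independent uniform permutation. *)
Lemma pmean_decorrelate (i j : 'I_n) (q : 'I_n -> 'I_n -> R) (X : 'S_n -> R)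
  (c : R) : i != j ->
  (forall i' j' : 'I_n, i' != j' ->
    `|pmean (fun s => q (s i') (s j') *
        (X (pairperm i j i' j' * s)%g - X s))| <= c) ->
  `|pmean (fun s => q (s i) (s j) * X s)
    - pmean (fun s => q (s i) (s j)) * pmean X| <= c.
Proof.
move=> ij Hc.
(* For each [p], the moved permutation takes at [i] and [j] the values of [s] at [p i] and [p j]. *)
have H1 : pmean (fun s => q (s i) (s j) * X s) = pmean (fun p : 'S_n =>
   pmean (fun s => q (s (p i)) (s (p j)) * X (pairperm i j (p i) (p j) * s)%g)).
  rewrite -[LHS]pmean_cst; apply: eq_pmean => p.
  rewrite -(pmean_mull (pairperm i j (p i) (p j))); apply: eq_pmean => s.
  by rewrite !(permM _ s) pairpermL ?pairpermR ?(inj_eq perm_inj).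
(* For fixed [s] the product of a uniform [p] with [s] is uniform, so averaging [q] over [p] gives a
   value free of [s]. *)
have H2 : pmean (fun s => q (s i) (s j)) * pmean X =
   pmean (fun p : 'S_n => pmean (fun s => q (s (p i)) (s (p j)) * X s)).
  rewrite pmean_exchange -pmeanZ; apply: eq_pmean => s.
  rewrite pmeanZr; congr (_ * _).
  by rewrite -(pmean_mulr s); apply: eq_pmean => p; rewrite !permM.
rewrite H1 H2 -pmeanB; apply: le_trans (ler_norm_pmean _) _.
rewrite -[leRHS]pmean_cst; apply: ler_pmean => p.
rewrite -pmeanB; under eq_pmean do rewrite -mulrBr.
by apply: Hc; rewrite (inj_eq perm_inj).
Qed.

(** The images of [i] and [j] form a uniform ordered pair of distinct indices; as [q] is
    nonnegative, n^2 may replace n(n - 1). *)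
Lemma pmean_pair_ge (i j : 'I_n) (q : 'I_n -> 'I_n -> R) : i != j ->
  (forall k l, 0 <= q k l) ->
  (\sum_(k : 'I_n) \sum_(l : 'I_n | k != l) q k l) / n%:R ^+ 2
  <= pmean (fun s => q (s i) (s j)).
Proof.
move=> ij q0; set e := pmean _.
have H (i' j' : 'I_n) : i' != j' -> pmean (fun s => q (s i') (s j')) = e.
  move=> ij'; rewrite -(pmean_mull (pairperm i' j' i j)).
  by apply: eq_pmean => s; rewrite -/(pairperm _ _ _ _) !(permM _ s) pairpermL// pairpermR.
have E : \sum_(k : 'I_n) \sum_(l : 'I_n | k != l) q k l =
    pmean (fun s => \sum_(k : 'I_n) \sum_(l : 'I_n | k != l) q (s k) (s l)).
  rewrite -[LHS]pmean_cst; apply: eq_pmean => s.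
  rewrite (reindex_inj (@perm_inj _ s)); apply: eq_bigr => k _.
  rewrite (reindex_inj (@perm_inj _ s)); apply: eq_bigl => l.
  by rewrite (inj_eq perm_inj).
have n0 : 0 < n%:R :> R by rewrite ltr0n; apply: leq_ltn_trans (ltn_ord i).
have e0 : 0 <= e by apply: pmean_ge0.
rewrite ler_pdivrMr ?exprn_gt0// E pmean_sum.
apply: (@le_trans _ _ (\sum_(k : 'I_n) \sum_(l : 'I_n) e)); last first.
  by rewrite !sumr_const card_ord expr2 -natrM mulr_natr mulrnA.
apply: ler_sum => k _; rewrite pmean_sum.
rewrite [leRHS](bigID (fun l => k != l))/= ler_wpDr ?sumr_ge0//.
by apply: ler_sum => l kl; rewrite H.
Qed.

Definition dep_on (A : Type) S (f : 'S_n -> A) :=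
  forall s s' : 'S_n, {in S, s =1 s'} -> f s = f s'.

Lemma dep_on_mull (A : Type) S e t (f : 'S_n -> A) s :
  dep_on S f -> perm_on e t -> [disjoint e & S] -> f (t * s)%g = f s.
Proof.
move=> df te eS; apply: df => x xS; rewrite permM (out_perm te)//.
by rewrite (disjointFl eS).
Qed.

Lemma dep_on_at S i : i \in S -> dep_on S (fun s => s i).
Proof. by move=> iS s s'; apply. Qed.

Lemma dep_on_comp (A B : Type) S (g : A -> B) (f : 'S_n -> A) :
  dep_on S f -> dep_on S (fun s => g (f s)).
Proof. by move=> df s s' /df ->. Qed.

Lemma dep_on_comp2 (A B C : Type) S (g : A -> B -> C) (f1 : 'S_n -> A)
  (f2 : 'S_n -> B) : dep_on S f1 -> dep_on S f2 ->
  dep_on S (fun s => g (f1 s) (f2 s)).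
Proof. by move=> d1 d2 s s' H; rewrite (d1 _ _ H) (d2 _ _ H). Qed.

End PermutationMean.

(** * Sums along a random permutation *)

Section PermutationSum.
Context {R : realType} {n : nat} (a : 'M[int]_n) (A : nat).
Hypothesis aA : forall i j, `|a i j| <= A%:Z.
Local Notation W := (perm_sum a).
Local Notation pmean := (@pmean R n).
Implicit Types (s t : 'S_n) (S e : {set 'I_n}).

Definition jump t s : int := W (t * s)%g - W s.

Lemma jumpE t s S : perm_on S t ->
  jump t s = \sum_(x in S) (a x (s (t x)) - a x (s x)).
Proof.
move=> tS; rewrite /jump /perm_sum -sumrB [LHS](bigID (mem S))/=.
rewrite [X in _ + X]big1 ?addr0; last first.
  by move=> x xS; rewrite permM (out_perm tS)// subrr.
by apply: eq_bigr => x _; rewrite permM.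
Qed.

Lemma jump_dep t S : perm_on S t -> dep_on S (jump t).
Proof.
move=> tS s s' ss'; rewrite !(jumpE _ tS); apply: eq_bigr => x xS.
by rewrite !ss'// perm_closed.
Qed.

Lemma jump_le t s S : perm_on S t -> `|jump t s| <= (2 * A * #|S|)%:Z.
Proof.
move=> tS; rewrite (jumpE _ tS); apply: le_trans (ler_norm_sum _ _ _) _.
apply: (@le_trans _ _ (\sum_(x in S) (2 * A)%:Z)).
  apply: ler_sum => x _; apply: le_trans (ler_normB _ _) _.
  by rewrite mul2n -addnn PoszD lerD.
by rewrite sumr_const -mulr_natr natz -PoszM.
Qed.

Lemma jump_tperm i j s : jump (tperm i j) s =
  a i (s j) + a j (s i) - a i (s i) - a j (s j).
Proof.
have [<-|ij] := eqVneq i j; first by rewrite tperm1 /jump mul1g subrr; ring.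
have tS : perm_on [set i; j] (tperm i j).
  apply/fintype.subsetP => z; rewrite !inE.
  by case: tpermP => [->|->|]//; rewrite eqxx ?orbT.
rewrite (jumpE _ tS) big_setU1 ?inE//= big_set1 tpermL tpermR; ring.
Qed.

(** Every block that meets [S] is the block of some point of [S]. *)
Lemma card_meeting (J : {set {set 'I_n}}) S : finset.trivIset J ->
  (#|[set e in J | ~~ [disjoint e & S]]| <= #|S|)%N.
Proof.
move=> tJ; apply: (leq_trans _ (leq_imset_card (finset.pblock J) S)).
apply: subset_leq_card; apply/fintype.subsetP => e.
rewrite inE => /andP[eJ /pred0Pn[x /andP[/= xe xS]]].
by apply/imsetP; exists x => //; rewrite (finset.def_pblock tJ eJ xe).
Qed.

(** * Averaging over swaps along disjoint pairs *)

Section Smoothing.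
Variables (t : {set 'I_n} -> 'S_n) (tP : forall e, perm_on e (t e)).

(** Each [t e] preserves the uniform law and, by disjointness, changes neither [psi] nor the jumps
    along the other pairs; averaging over whether it is applied puts one more [avg] on [H]. *)
Lemma pmean_avgs (L : seq {set 'I_n}) S (psi : 'S_n -> R) (H : int -> R) :
  dep_on S psi -> pairwise (fun e e' => [disjoint e & e']) L ->
  all (fun e : {set 'I_n} => [disjoint e & S]) L ->
  pmean (fun s => psi s * H (W s)) =
  pmean (fun s => psi s * avgs [seq jump (t e) s | e <- L] H (W s)).
Proof.
move=> dpsi; elim: L => [|e L IH]/=; first by [].
move=> /andP[/allP eL pL] /andP[eS LS]; rewrite IH//.
rewrite -[LHS]mulr1 -[1](@divff _ 2)// mulrA mulr_natr mulr2n.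
rewrite -{2}(pmean_mull (t e)) -pmeanD -pmeanZr; apply: eq_pmean => s.
rewrite (dep_on_mull _ dpsi (tP e))// /avg -mulrDr -mulrA; congr (_ * (_ / _)).
congr (_ + _); have -> : W (t e * s)%g = W s + jump (t e) s.
  by rewrite /jump addrC subrK.
congr (avgs _ _ _); apply/eq_in_map => e' e'L.
by rewrite (dep_on_mull _ (jump_dep (tP e')) (tP e))// eL.
Qed.

Definition nb_unit_jumps (L : seq {set 'I_n}) s : nat :=
  count (fun e => `|jump (t e) s| == 1) L.

(** How many steps have size one depends on [s], so the smoothing bound [beta] is taken at a random
    count and then averaged. *)
Lemma pmean_smooth (L : seq {set 'I_n}) S (psi : 'S_n -> R) (H : int -> R)
    (B : R) (beta : nat -> R) :
  dep_on S psi -> (forall s, `|psi s| <= B) ->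
  pairwise (fun e e' => [disjoint e & e']) L ->
  all (fun e : {set 'I_n} => [disjoint e & S]) L ->
  (forall k m, `|avgn k H m| <= beta k) ->
  `|pmean (fun s => psi s * H (W s))|
  <= B * pmean (fun s => beta (nb_unit_jumps L s)).
Proof.
move=> dpsi psiB pL LS Hb; rewrite (pmean_avgs H dpsi pL LS).
apply: le_trans (ler_norm_pmean _) _; rewrite -pmeanZ; apply: ler_pmean => s.
rewrite normrM ler_pM//; apply: avgs_bound => m.
by rewrite count_map; exact: Hb.
Qed.

(* Swapping along a pair that meets [S] could change [psi]; the pairs being
   disjoint, at most four of them do, hence the [- 4]. *)
Lemma pmean_smooth_unit (I : {set {set 'I_n}}) S (psi : 'S_n -> R) (H : int -> R)
    (B : R) (beta : nat -> R) : finset.trivIset I -> (#|S| <= 4)%N ->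
  dep_on S psi -> (forall s, `|psi s| <= B) ->
  (forall k m, `|avgn k H m| <= beta k) ->
  (forall k l, (k <= l)%N -> beta l <= beta k) ->
  `|pmean (fun s => psi s * H (W s))|
  <= B * pmean (fun s => beta (nb_unit_jumps (enum I) s - 4)%N).
Proof.
move=> tI S4 dpsi psiB Hb beta_dec.
have B0 : 0 <= B by apply: le_trans (psiB 1%g).
pose L := seq.filter (fun e : {set 'I_n} => [disjoint e & S]) (enum I).
apply: le_trans (@pmean_smooth L S psi H B beta dpsi psiB _ _ Hb) _.
- apply: pairwise_filter; have := enum_uniq (mem I); rewrite uniq_pairwise.
  apply: (sub_in_pairwise (P := mem I)); last by apply/allP => e; rewrite mem_enum.
  by move=> e e' eI e'I; exact: (finset.trivIsetP tI).
- by apply/allP => e; rewrite mem_filter => /andP[].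
rewrite ler_wpM2l//; apply: ler_pmean => s; apply: beta_dec.
rewrite leq_subLR addnC /nb_unit_jumps.
have count_le (U D : pred {set 'I_n}) xs :
    (count U xs <= count U (seq.filter D xs) + count (predC D) xs)%N.
  by elim: xs => //= x xs IH; case: (D x) => /=; lia.
apply: leq_trans (count_le _ (fun e : {set 'I_n} => [disjoint e & S]) _) _.
rewrite leq_add2l -sum1_count big_enum_cond sum1dep_card.
exact: leq_trans (card_meeting S tI) S4.
Qed.

End Smoothing.

(** * Concentration of the number of unit jumps *)

Section UnitJumps.
Variables (I : {set {set 'I_n}}) (t : {set 'I_n} -> 'S_n).
Hypotheses (tP : forall e, perm_on e (t e)) (tI : finset.trivIset I).
Variable p : R.
Hypothesis unit_jump : forall e, e \in I -> exists i j,
  [/\ i != j, e = [set i; j]%SET, t e = tperm i j &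
   p <= pmean (fun s => (`|jump (t e) s| == 1)%:R)].

Let N s : R := (nb_unit_jumps t (enum I) s)%:R.

Let good e s : R := (`|jump (t e) s| == 1)%:R.

Let N_E s : N s = \sum_(e in I) good e s.
Proof.
rewrite /N /nb_unit_jumps -sum1_count natr_sum big_enum_cond/= big_mkcondr/=.
by apply: eq_bigr => e _; rewrite /good; case: (_ == _).
Qed.

(** Pairs disjoint from [S] keep their jump; at most [#|S|] others exist, and each indicator changes
    by at most 1. *)
Let N_lip u S s : perm_on S u -> `|N (u * s)%g - N s| <= #|S|%:R.
Proof.
move=> uS; rewrite !N_E -sumrB (bigID (fun e : {set 'I_n} => [disjoint e & S]))/=.
rewrite big1 ?add0r => [|e /andP[eI eS]]; last first.
  rewrite /good (dep_on_mull _ (jump_dep (tP e)) uS) ?subrr// disjoint_sym//.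
apply: le_trans (ler_norm_sum _ _ _) _.
apply: (@le_trans _ _ (\sum_(e in I | ~~ [disjoint e & S]) 1)%N%:R).
  rewrite natr_sum.
  apply: ler_sum => e _; rewrite /good.
  by do 2 case: (_ == _); rewrite ?subrr ?subr0 ?sub0r ?normrN ?normr1 ?normr0.
rewrite ler_nat sum1dep_card.
exact: card_meeting.
Qed.

(** The variance is the sum over [e] of the covariances of [good e] with [N]. Decorrelation moves
    the permutation at four points, hence [N] by at most 4, which bounds each covariance by 4. *)
Let variance_N : pmean (fun s => (N s - pmean N) ^+ 2) <= 4 * #|I|%:R.
Proof.
set m := pmean N.
have -> : pmean (fun s => (N s - m) ^+ 2) =
    \sum_(e in I) (pmean (fun s => good e s * N s) - pmean (good e) * m).
  rewrite sumrB -pmean_sum -mulr_suml -pmean_sum.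
  have -> : pmean (fun s => \sum_(e in I) good e s) = m.
    by apply: eq_pmean => s; rewrite N_E.
  have -> : pmean (fun s => \sum_(e in I) good e s * N s) = pmean (fun s => N s * N s).
    by apply: eq_pmean => s; rewrite -mulr_suml -N_E.
  transitivity (pmean (fun s => N s * N s + ((-2 * m) * N s + m * m))).
    by apply: eq_pmean => s; ring.
  by rewrite !pmeanD pmean_cst pmeanZ -/m; ring.
rewrite mulr_natr -sumr_const; apply: ler_sum => e eI.
have [i [j [ij eE te _]]] := unit_jump eI.
apply: le_trans (ler_norm _) _.
pose q k l : R := (`|a i l + a j k - a i k - a j l| == 1)%:R.
have gE s : good e s = q (s i) (s j) by rewrite /good te jump_tperm.
have -> : pmean (fun s => good e s * N s) = pmean (fun s => q (s i) (s j) * N s).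
  by apply: eq_pmean => s; rewrite gE.
have -> : pmean (good e) = pmean (fun s => q (s i) (s j)).
  by apply: eq_pmean => s; rewrite gE.
apply: pmean_decorrelate => // i' j' ij'.
apply: le_trans (ler_norm_pmean _) _; rewrite -[leRHS](@pmean_cst R n).
apply: ler_pmean => s; rewrite normrM -[leRHS]mul1r ler_pM//.
  by rewrite /q; case: (_ == _); rewrite ?normr1 ?normr0.
apply: le_trans (N_lip _ (pairperm_on i j i' j')) _; rewrite ler_nat.
exact: card_set4.
Qed.

Let mean_N : p * #|I|%:R <= pmean N.
Proof.
have -> : pmean N = \sum_(e in I) pmean (good e).
  by rewrite -pmean_sum; apply: eq_pmean => s; rewrite N_E.
rewrite mulr_natr -sumr_const; apply: ler_sum => e eI.
by have [i [j []]] := unit_jump eI.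
Qed.

(** Chebyshev: 1/(N + 1) is at most 2/m if N >= m/2, and otherwise at most 1 <= 4(N - m)^2/m^2. The
    variance bound and m >= p |I| then give the constant. *)
Lemma pmean_inv_unit_jumps : 0 < p -> (0 < #|I|)%N ->
  pmean (fun s => (nb_unit_jumps t (enum I) s).+1%:R^-1)
  <= (16 / p ^+ 2 + 2 / p) / #|I|%:R.
Proof.
move=> p0 I0; set c := #|I|%:R : R; set m := pmean N.
have c0 : 0 < c by rewrite ltr0n.
have m0 : 0 < m by apply: lt_le_trans mean_N; rewrite mulr_gt0.
apply: (@le_trans _ _ (pmean (fun s => 4 / m ^+ 2 * (N s - m) ^+ 2 + 2 / m))).
  apply: ler_pmean => s.
  have -> : (nb_unit_jumps t (enum I) s).+1%:R = N s + 1 by rewrite natr1.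
  have : 0 <= N s by [].
  set x := N s => x0.
  have [xm|mx] := leP (m / 2) x.
    have c1 : 0 <= 4 / m ^+ 2 * (x - m) ^+ 2.
      by apply: mulr_ge0; rewrite ?divr_ge0 ?sqr_ge0.
    apply: le_trans (ler_wpDl c1 (lexx _)).
    rewrite -[leRHS]invf_div lef_pV2 ?posrE ?divr_gt0//; lra.
  apply: (@le_trans _ _ 1); first by rewrite invf_le1; lra.
  have c2 : 0 <= 2 / m by rewrite divr_ge0 // ltW.
  apply: le_trans (ler_wpDr c2 (lexx _)).
  have -> : 4 / m ^+ 2 * (x - m) ^+ 2 = 4 * (x - m) ^+ 2 / m ^+ 2 by ring.
  rewrite ler_pdivlMr ?exprn_gt0// mul1r.
  have : 0 <= (m - 2 * x) * (3 * m - 2 * x) by rewrite mulr_ge0; lra.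
  lra.
rewrite pmeanD pmean_cst pmeanZ.
have pc0 : 0 < p * c by rewrite mulr_gt0.
have mp : m^-1 <= (p * c)^-1 by rewrite lef_pV2 ?posrE.

have -> : (16 / p ^+ 2 + 2 / p) / c = 4 * (p * c)^-1 ^+ 2 * (4 * c) + 2 * (p * c)^-1.
  by field; rewrite !gt_eqF.
apply: lerD; last by rewrite ler_wpM2l.
apply: ler_pM; last exact: variance_N.
- by rewrite divr_ge0 ?sqr_ge0.
- by apply: pmean_ge0 => s; rewrite sqr_ge0.
- by rewrite -exprVn ler_wpM2l// lerXn2r// nnegrE invr_ge0 ltW.
Qed.

End UnitJumps.
End PermutationSum.

(** * The exchangeable pair *)

(** The range of the sum does not depend on [x]. A random shift thus enters only through indicators,
    which can be absorbed into [psi], while the differences sit at deterministic offsets. *)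
Lemma telescope_ind {R : realType} (F : int -> R) (w x : int) (M : nat) :
  0 <= x -> x <= M ->
  F (w + x) - F w = \sum_(m < M) (m%:Z < x)%R%:R * fdiff F (w + m%:Z).
Proof.
case: x => // k _; rewrite lez_nat => kM.
(* With [minn k M] the identity holds for every [M], so the induction can drop [k <= M]. *)
have -> : k = minn k M by lia.
have -> : \sum_(m < M) (m%:Z < (minn k M)%:Z)%R%:R * fdiff F (w + m%:Z) =
    \sum_(m < M) (m < k)%N%:R * fdiff F (w + m%:Z).
  by apply: eq_bigr => m _; rewrite ltz_nat; congr (_%:R * _); have := ltn_ord m; lia.
elim: M {kM} => [|M IH]; first by rewrite big_ord0 minn0 addr0 subrr.
rewrite big_ord_recr/= -IH; have [kM|Mk] := leqP k M.
  by rewrite (minn_idPl _) 1?(minn_idPl _) ?mul0r ?addr0//; lia.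
rewrite !(minn_idPr _) ?mul1r /fdiff; [|lia..].
by rewrite addrC addrA subrK -addrA -PoszD addn1.
Qed.

Section ExchangeablePair.
Context {R : realType} {n : nat} (a : 'M[int]_n) (K : nat).
Local Notation W := (perm_sum a).
Local Notation pmean := (@pmean R n).
Local Notation D i j := (fun s => (jump a (tperm i j) s)%:~R : R).
Implicit Types (s t : 'S_n) (S : {set 'I_n}).

(** Composing with the transposition exchanges the two values of the sum and reverses the jump;
    hence the jump times g(W + jump) + g(W) has mean zero. *)
Lemma pmean_jump_antisym (g : int -> R) i j :
  pmean (fun s => D i j s * (g (W s + jump a (tperm i j) s) - g (W s)))
  = - 2 * pmean (fun s => D i j s * g (W s)).
Proof.
set G := fun s => D i j s * (g (W (tperm i j * s)%g) + g (W s)).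
have G0 : pmean G = 0.
  have : pmean G = - pmean G.
    rewrite -{1}(pmean_mull (tperm i j)) -pmeanN; apply: eq_pmean => s.
    rewrite /G /jump mulgA tperm2 mul1g !rmorphB/=; ring.
  lra.
transitivity (pmean (fun s => G s + - 2 * (D i j s * g (W s)))).
  apply: eq_pmean => s; rewrite /G.
  have -> : W s + jump a (tperm i j) s = W (tperm i j * s)%g.
    by rewrite /jump addrC subrK.
  ring.
by rewrite pmeanD G0 add0r pmeanZ.
Qed.

Let Wr s : R := (W s)%:~R.
Let mu : R := pmean Wr.

(** The linear regression property of the exchangeable pair, summed over all ordered pairs of
    indices. *)
Lemma sum_jump s : \sum_i \sum_j D i j s = 2 * n%:R * (mu - Wr s).
Proof.
set T : R := \sum_i \sum_j (a i j)%:~R.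
have sumE s' : \sum_i \sum_j D i j s' = 2 * T - 2 * n%:R * Wr s'.
  transitivity (\sum_i \sum_j ((a i (s' j))%:~R + (a j (s' i))%:~R
      - (a i (s' i))%:~R - (a j (s' j))%:~R : R)).
    by apply: eq_bigr => i _; apply: eq_bigr => j _; rewrite jump_tperm !(rmorphB, rmorphD).
  under eq_bigr do rewrite !sumrB big_split/= sumr_const card_ord.
  rewrite !sumrB big_split/= sumr_const card_ord sumrMnl.
  have -> : \sum_i \sum_j (a i (s' j))%:~R = T.
    by apply: eq_bigr => i _; rewrite [RHS](reindex_inj (@perm_inj _ s')).
  have -> : \sum_i \sum_j (a j (s' i))%:~R = T.
    rewrite exchange_big/=; apply: eq_bigr => i _.
    by rewrite [RHS](reindex_inj (@perm_inj _ s')).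
  have -> : \sum_i (a i (s' i))%:~R = Wr s' by rewrite /Wr /perm_sum rmorph_sum.
  by rewrite -(mulr_natr (Wr s')); ring.
(* Each jump has mean zero; taking means in [sumE] therefore identifies [T] with n mu. *)
rewrite sumE; have : pmean (fun s => \sum_i \sum_j D i j s) = 0.
  rewrite pmean_sum big1// => i _; rewrite pmean_sum big1// => j _.
  rewrite /jump; under eq_pmean do rewrite rmorphB.
  by rewrite pmeanB (pmean_mull _ (fun s => (W s)%:~R)) subrr.
under eq_pmean do rewrite sumE.
rewrite pmeanB pmean_cst pmeanZ -/mu => /subr0_eq ->; ring.
Qed.

Lemma pmean_exchangeable (g : int -> R) :
  \sum_i \sum_j pmean (fun s => D i j s * (g (W s + jump a (tperm i j) s) - g (W s)))
  = 4 * n%:R * pmean (fun s => (Wr s - mu) * g (W s)).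
Proof.
under eq_bigr do under eq_bigr do rewrite pmean_jump_antisym.
under eq_bigr do rewrite -mulr_sumr -pmean_sum.
rewrite -mulr_sumr -pmean_sum -!pmeanZ; apply: eq_pmean => s.
under eq_bigr do rewrite -mulr_suml.
by rewrite -mulr_suml sum_jump; ring.
Qed.

(** The preceding identity with [g] the inclusion of the integers, together with the fact that Wr -
    mu is centred. *)
Lemma pmean_sqr_jump :
  \sum_i \sum_j pmean (fun s => D i j s ^+ 2)
  = 4 * n%:R * pmean (fun s => (Wr s - mu) ^+ 2).
Proof.
have -> : pmean (fun s => (Wr s - mu) ^+ 2) = pmean (fun s => (Wr s - mu) * (W s)%:~R).
  transitivity (pmean (fun s => (Wr s - mu) * Wr s - mu * (Wr s - mu))).
    by apply: eq_pmean => s; ring.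
  by rewrite pmeanB pmeanZ (pmeanB Wr) pmean_cst subrr mulr0 subr0.
rewrite -(pmean_exchangeable intr); apply: eq_bigr => i _; apply: eq_bigr => j _.
by apply: eq_pmean => s; rewrite /= intrD [X in _ * X]addrAC subrr add0r expr2.
Qed.

Hypothesis jumpK : forall t S, (#|S| <= 4)%N -> perm_on S t ->
  forall s, `|jump a t s| <= K.

Let jump_tpermK i j s : `|jump a (tperm i j) s| <= K.
Proof.
have -> : tperm i j = pairperm i i j j by rewrite /pairperm tpermL tperm1 mulg1.
exact: jumpK (card_set4 i i j j) (pairperm_on i i j j) s.
Qed.

Let jump_tpermKr i j s : `|(jump a (tperm i j) s)%:~R| <= K%:R :> R.
Proof. by rewrite -intr_norm -[K%:R]/(K%:Z%:~R) ler_int jump_tpermK. Qed.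

Variables (g : int -> R) (eps : R).
Local Notation h := (fdiff g).
Hypothesis smooth : forall S (psi : 'S_n -> R) (B : R) (m : int),
  (#|S| <= 4)%N -> dep_on S psi -> (forall s, `|psi s| <= B) ->
  `|pmean (fun s => psi s * fdiff h (W s + m))| <= B * eps.

(** Telescoping both terms from W - K leaves 2K second differences at fixed offsets, with
    coefficients in {-1, 0, 1} determined on [S]. *)
Lemma pmean_shift S (psi : 'S_n -> R) (B : R) (x y : 'S_n -> int) :
  (#|S| <= 4)%N -> dep_on S psi -> (forall s, `|psi s| <= B) ->
  dep_on S x -> (forall s, `|x s| <= K) ->
  dep_on S y -> (forall s, `|y s| <= K) ->
  `|pmean (fun s => psi s * (h (W s + x s) - h (W s + y s)))|
  <= 2 * K%:R * (B * eps).
Proof.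
move=> S4 dpsi psiB dx xK dy yK.
pose c (m : nat) s : R := (m%:Z < x s + K)%R%:R - (m%:Z < y s + K)%R%:R.
have -> : pmean (fun s => psi s * (h (W s + x s) - h (W s + y s))) =
  \sum_(m < K + K) pmean (fun s => psi s * c m s * fdiff h (W s + (m%:Z - K%:Z))).
  rewrite -pmean_sum; apply: eq_pmean => s.
  have E z : `|z| <= K%:Z -> h (W s + z) - h (W s - K%:Z) =
      \sum_(m < K + K) (m%:Z < z + K)%R%:R * fdiff h (W s + (m%:Z - K%:Z)).
    move=> zK; have -> : W s + z = W s - K%:Z + (z + K) by ring.
    rewrite (@telescope_ind _ h _ (z + K%:Z) (K + K)); [|lia..].
    by apply: eq_bigr => m _; congr (_ * fdiff h _); ring.
  have -> : h (W s + x s) - h (W s + y s) =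
    (h (W s + x s) - h (W s - K%:Z)) - (h (W s + y s) - h (W s - K%:Z)) by ring.
  rewrite !E// -sumrB mulr_sumr; apply: eq_bigr => m _; rewrite /c; ring.
apply: le_trans (ler_norm_sum _ _ _) _.
apply: (@le_trans _ _ (\sum_(m < K + K) B * eps)); last first.
  rewrite sumr_const card_ord -[_ *+ (K + K)]mulr_natl natrD le_eqVlt.
  by apply/orP; left; apply/eqP; ring.
apply: ler_sum => m _; apply: (smooth _ S4).
  by apply: dep_on_comp2 dpsi _; exact: (dep_on_comp2 (fun u v : int =>
    (m%:Z < u + K)%R%:R - (m%:Z < v + K)%R%:R) dx dy).
move=> s; rewrite normrM -[B]mulr1 ler_pM// /c.
by do 2 case: (_ < _)%R; rewrite ?subrr ?subr0 ?sub0r ?normrN ?normr1 ?normr0.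
Qed.

(** The remainder is a sum of 2K terms in h(W + m - K) - h(W), each costing 2K by [pmean_shift];
    hence 4 K^2. *)
Lemma pmean_taylor S (psi : 'S_n -> R) (B : R) (x : 'S_n -> int) :
  (#|S| <= 4)%N -> dep_on S psi -> (forall s, `|psi s| <= B) ->
  dep_on S x -> (forall s, `|x s| <= K) ->
  `|pmean (fun s => psi s * (g (W s + x s) - g (W s) - (x s)%:~R * h (W s)))|
  <= 4 * K%:R ^+ 2 * (B * eps).
Proof.
move=> S4 dpsi psiB dx xK.
pose c (m : nat) s : R := (m%:Z < x s + K)%R%:R - (m%:Z < K%:Z)%R%:R.
have E (F : int -> R) s : F (W s + x s) - F (W s) =
    \sum_(m < K + K) c m s * fdiff F (W s + (m%:Z - K%:Z)).
  have -> : W s + x s = W s - K%:Z + (x s + K) by ring.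
  have {2}-> : W s = W s - K%:Z + K%:Z by ring.
  set w := W s - _; have xKs := xK s.
  have -> : F (w + (x s + K)) - F (w + K) =
    F (w + (x s + K)) - F w - (F (w + K) - F w) by ring.
  rewrite (@telescope_ind _ F _ (x s + K%:Z) (K + K)); [|lia..].
  rewrite (@telescope_ind _ F _ K%:Z (K + K)); [|lia..].
  rewrite -sumrB; apply: eq_bigr => m _; rewrite /c.
  have -> : W s + (m%:Z - K%:Z) = w + m%:Z by rewrite /w; ring.
  ring.
(* The expansion [E] for the identity function: the coefficients add up to the shift itself. *)
have xE s : (x s)%:~R = \sum_(m < K + K) c m s :> R.
  have := E intr s; rewrite intrD addrAC subrr add0r => ->.
  by apply: eq_bigr => m _; rewrite /fdiff intrD addrAC subrr add0r mulr1.
have -> : pmean (fun s => psi s * (g (W s + x s) - g (W s) - (x s)%:~R * h (W s)))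
  = \sum_(m < K + K) pmean (fun s => psi s * c m s *
      (h (W s + (m%:Z - K%:Z)) - h (W s + 0))).
  rewrite -pmean_sum; apply: eq_pmean => s.
  rewrite E xE mulr_suml -sumrB mulr_sumr; apply: eq_bigr => m _.
  by rewrite addr0; ring.
apply: le_trans (ler_norm_sum _ _ _) _.
apply: (@le_trans _ _ (\sum_(m < K + K) 2 * K%:R * (B * eps))); last first.
  rewrite sumr_const card_ord -[_ *+ (K + K)]mulr_natl natrD expr2 le_eqVlt.
  by apply/orP; left; apply/eqP; ring.
apply: ler_sum => m _; apply: (pmean_shift S4) => //.
- apply: dep_on_comp2 dpsi _; exact: (dep_on_comp (fun u : int =>
    (m%:Z < u + K)%R%:R - (m%:Z < K%:Z)%R%:R) dx).
- move=> s; rewrite normrM -[B]mulr1 ler_pM// /c.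
  by do 2 case: (_ < _)%R; rewrite ?subrr ?subr0 ?sub0r ?normrN ?normr1 ?normr0.
- by move=> _; have := ltn_ord m; lia.
Qed.

(** For each pair of indices, a Taylor expansion replaces the increment of [g] by the jump times
    h(W), and decorrelation separates the squared jump from h(W). Summing the squared jumps produces
    the variance. *)
Lemma stein_exchangeable :
  `|pmean (fun s => (Wr s - mu) * g (W s))
    - pmean (fun s => (Wr s - mu) ^+ 2) * pmean (fun s => h (W s))|
  <= 2 * n%:R * K%:R ^+ 3 * eps.
Proof.
have eps0 : 0 <= eps.
  have := @smooth finset.set0 (fun=> 1) 1 0; rewrite cards0 normr1 mul1r.
  by move=> H; apply: le_trans (H _ _ _).
(* The general argument divides by 4n; for n = 0 the centred sum vanishes. *)
have [n0|n_gt0] := posnP n.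
  have W0 s : Wr s - mu = 0.
    have Wr0 s' : Wr s' = 0 by rewrite /Wr /perm_sum big1// => i; have := ltn_ord i; rewrite {2}n0.
    by rewrite Wr0 /mu (eq_pmean Wr0) pmean_cst subrr.
  rewrite (eq_pmean (G := fun=> 0)) => [|s]; last by rewrite W0 mul0r.
  rewrite [X in _ - X * _](eq_pmean (G := fun=> 0)) => [|s]; last by rewrite W0 expr0n.
  by rewrite pmean_cst mul0r subr0 normr0 !mulr_ge0// exprn_ge0.
(* The 6 is 4 from the Taylor remainder plus 2 from decorrelation; n^2 pairs divided by 4n give 3n/2
   times K^3 eps, within the claimed 2n. *)
set L := _ - _; set e3 := 6 * K%:R ^+ 3 * eps.
have e30 : 0 <= e3 by rewrite !mulr_ge0// exprn_ge0.
suff H : `|4 * n%:R * L| <= n%:R ^+ 2 * e3.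
  have n0 : 0 < n%:R :> R by rewrite ltr0n.
  move: H; rewrite normrM ger0_norm ?mulr_ge0// expr2 -!mulrA mulrCA ler_pM2l// /e3.
  have : 0 <= n%:R * (K%:R ^+ 3 * eps) by rewrite !mulr_ge0// exprn_ge0.
  by lra.
rewrite /L mulrBr [X in _ - X]mulrA -pmean_exchangeable -pmean_sqr_jump mulr_suml -sumrB.
apply: le_trans (ler_norm_sum _ _ _) _.
apply: (@le_trans _ _ (\sum_(i < n) \sum_(j < n) e3)); last first.
  by rewrite !sumr_const !card_ord -mulrnA -[X in X <= _]mulr_natl natrM.
apply: ler_sum => i _; rewrite mulr_suml -sumrB.
apply: le_trans (ler_norm_sum _ _ _) _.
apply: ler_sum => j _; have [<-|ij] := eqVneq i j.
  rewrite tperm1; rewrite (eq_pmean (G := fun=> 0)) => [|s]; last first.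
    by rewrite /jump mul1g subrr mul0r.
  rewrite (eq_pmean (F := fun s => _ ^+ 2) (G := fun=> 0)) => [|s]; last first.
    by rewrite /jump mul1g subrr expr0n.
  by rewrite pmean_cst mul0r subr0 normr0.
set d := D i j.
have jK s : `|d s| <= K%:R by exact: jump_tpermKr.
have dij : dep_on [set i; j] (jump a (tperm i j)).
  apply: jump_dep; apply/fintype.subsetP => z; rewrite !inE.
  by case: tpermP => [->|->|]//; rewrite eqxx ?orbT.
have c2 : (#|[set i; j]| <= 4)%N by rewrite cards2; case: (_ != _).
have -> : pmean (fun s => d s * (g (W s + jump a (tperm i j) s) - g (W s)))
    - pmean (fun s => d s ^+ 2) * pmean (fun s => h (W s))
  = pmean (fun s => d s * (g (W s + jump a (tperm i j) s) - g (W s) - d s * h (W s)))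
    + (pmean (fun s => d s ^+ 2 * h (W s))
       - pmean (fun s => d s ^+ 2) * pmean (fun s => h (W s))).
  rewrite addrA -pmeanD; congr (_ - _); apply: eq_pmean => s; ring.
apply: le_trans (ler_normD _ _) _.
have -> : e3 = 4 * K%:R ^+ 2 * (K%:R * eps) + 2 * K%:R * (K%:R ^+ 2 * eps).
  by rewrite /e3; ring.
apply: lerD.
  by apply: (pmean_taylor c2) => //; exact: (dep_on_comp intr dij).
pose q k l : R := (a i l + a j k - a i k - a j l)%:~R ^+ 2.
have qE s : d s ^+ 2 = q (s i) (s j) by rewrite /d jump_tperm.
have -> : pmean (fun s => d s ^+ 2 * h (W s)) = pmean (fun s => q (s i) (s j) * h (W s)).
  by apply: eq_pmean => s; rewrite qE.
have -> : pmean (fun s => d s ^+ 2) = pmean (fun s => q (s i) (s j)).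
  by apply: eq_pmean => s; rewrite qE.
apply: pmean_decorrelate => // i' j' ij'.
rewrite (eq_pmean (G := fun s => q (s i') (s j') * (h (W s + jump a (pairperm i j i' j') s)
  - h (W s + 0)))) => [|s]; last by rewrite addr0 /jump (addrC (W s)) subrK.
have S4 := card_set4 i j i' j'.
apply: (@pmean_shift _ (fun s => q (s i') (s j')) (K%:R ^+ 2)
  (jump a (pairperm i j i' j')) (fun=> 0) S4).
- apply: (dep_on_comp2 q); apply: dep_on_at; rewrite !inE eqxx ?orbT//.
(* This [q] is the squared jump of the moved permutation, so the bound on jumps applies to it. *)
- move=> s; have <- : d (pairperm i j i' j' * s)%g ^+ 2 = q (s i') (s j').
    by rewrite qE !(permM _ s) pairpermL// pairpermR.
  by rewrite normrX lerXn2r ?nnegrE.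
- exact/jump_dep/pairperm_on.
- exact: jumpK S4 (pairperm_on _ _ _ _).
- by [].
- by move=> s; rewrite normr0.
Qed.

End ExchangeablePair.

(** * The Stein-Chen equation *)

(* [p] is the Poisson weight function, [e] its restriction to a set of mass
   [q], and [stein_sol] solves the Stein-Chen equation for that set. *)
Section PoissonStein.
Local Open Scope classical_set_scope.
Context {R : realType} (lam : R) (p : nat -> R).
Hypotheses (lam0 : 0 < lam) (p_gt0 : forall k, 0 < p k).
Hypothesis pS : forall k, k.+1%:R * p k.+1 = lam * p k.
Local Notation C k := (\sum_(j < k.+1) p j).
Hypothesis C1 : (fun k => C k) @ \oo --> (1 : R).

Let p0 k : 0 <= p k. Proof. exact: ltW. Qed.
Let CS k : C k.+1 = C k + p k.+1. Proof. by rewrite big_ord_recr. Qed.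

Let C_ge0 k : 0 <= C k. Proof. by apply: sumr_ge0. Qed.

Let C_le1 k : C k <= 1.
Proof.
rewrite -(cvg_lim (@Rhausdorff R) C1); apply: nondecreasing_cvgn_le.
  by apply/nondecreasing_seqP => j; rewrite CS lerDl.
by apply/cvg_ex; exists 1.
Qed.

(** The ratio of consecutive weights, lam/(k + 1), decreases in k. *)
Let p_logconcave j k : (j <= k)%N -> p j * p k.+1 <= p j.+1 * p k.
Proof.
have pE i : p i.+1 = lam * p i / i.+1%:R.
  by rewrite -pS mulrAC mulfV ?mul1r// pnatr_eq0.
move=> jk; rewrite !pE mulrA [leRHS]mulrAC -!mulrA.
have -> : p j * (lam * (p k * k.+1%:R^-1)) = lam * p j * p k * k.+1%:R^-1 by ring.
have -> : lam * (p j * (p k * j.+1%:R^-1)) = lam * p j * p k * j.+1%:R^-1 by ring.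
apply: ler_wpM2l; first by rewrite !mulr_ge0 ?ltW.
by rewrite lef_pV2 ?posrE ?ltr0n// ler_nat.
Qed.

(** That is, C/p is nondecreasing: drop the first term of [C k.+1] and compare the others by
    log-concavity. *)
Let C_step k : C k * p k.+1 <= C k.+1 * p k.
Proof.
rewrite [C k.+1]big_ord_recl mulrDl.
apply: (@le_trans _ _ ((\sum_(j < k.+1) p j.+1) * p k)); last first.
  by rewrite lerDr mulr_ge0.
rewrite !mulr_suml; apply: ler_sum => j _; apply: p_logconcave.
by rewrite -ltnS.
Qed.

(** That is, (1 - C)/p is nonincreasing: log-concavity compares finite pieces of the two tails, and
    a limit finishes. *)
Let T_step k : (1 - C k.+1) * p k <= (1 - C k) * p k.+1.
Proof.
have H m : p k * (C (k.+1 + m)%N - C k.+1) <= p k.+1 * (C (k + m)%N - C k).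
  elim: m => [|m IH]; first by rewrite !addn0 !subrr !mulr0.
  have L : p k * p (k.+1 + m).+1 <= p k.+1 * p (k.+1 + m)%N.
    by apply: p_logconcave; lia.
  by move: IH L; rewrite !addnS !addSn !CS; lra.
have cv m : (fun i => C (m + i)%N) @ \oo --> (1 : R).
  have -> : (fun i => C (m + i)%N) = (fun i => C (i + m)%N).
    by apply/funext => i; rewrite addnC.
  by have := C1; rewrite -(cvg_shiftn m).
rewrite mulrC [leRHS]mulrC.
have c1 : (fun m => p k * (C (k.+1 + m)%N - C k.+1)) @ \oo --> p k * (1 - C k.+1).
  by apply: cvgMr; apply: cvgB; [exact: cv | exact: cvg_cst].
have c2 : (fun m => p k.+1 * (C (k + m)%N - C k)) @ \oo --> p k.+1 * (1 - C k).
  by apply: cvgMr; apply: cvgB; [exact: cv | exact: cvg_cst].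
by apply: (ler_cvg_to c1 c2); apply: nearW.
Qed.

Let C_lam k : lam * C k <= k.+1%:R * C k.+1.
Proof.
rewrite [C k.+1]big_ord_recl mulrDr ler_wpDl ?mulr_ge0//.
rewrite !mulr_sumr; apply: ler_sum => j _; rewrite -pS.
by rewrite ler_wpM2r// ler_nat.
Qed.

(** Forward summation of the Stein-Chen recursion, with value at [k.+1] built from the sums up to
    [k]. The extension by 0 covers values of the sum below the shift. *)
Definition stein_sol (e : nat -> R) (q : R) (m : int) : R :=
  if m is Posz k.+1 then (\sum_(j < k.+1) e j - q * C k) / (lam * p k) else 0.

Lemma stein_sol_eq (e : nat -> R) (q : R) k :
  lam * stein_sol e q (k%:Z + 1) - k%:R * stein_sol e q k%:Z = e k / p k - q.
Proof.
rewrite -PoszD addn1 /=; case: k => [|k].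
  rewrite mul0r subr0 !big_ord1; field.
  by rewrite !gt_eqF.
rewrite /stein_sol [in X in X - _]big_ord_recr CS /=.
have -> : lam * p k.+1 = p k.+1 * lam by rewrite mulrC.
rewrite -(pS k); field.
by rewrite !gt_eqF ?ltr0n//= nat1r gt_eqF ?ltr0n.
Qed.

Lemma stein_sol_neg (e : nat -> R) (q : R) m : m <= 0 -> stein_sol e q m = 0.
Proof. by case: m => // -[]. Qed.

(** The inequalities say that [e] lies below [p] and that its mass beyond [k] lies between 0 and the
    Poisson tail. They are stable under complement. *)
Definition admissible (e : nat -> R) (q : R) := (forall k, 0 <= e k <= p k) /\
  forall k, 0 <= q - \sum_(j < k.+1) e j <= 1 - C k.

Let admissibleC e q : admissible e q -> admissible (fun k => p k - e k) (1 - q).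
Proof.
move=> [H1 H2]; split=> k; first by have := H1 k; lra.
by rewrite sumrB; have := H2 k; lra.
Qed.

Let stein_solC e q m : stein_sol (fun k => p k - e k) (1 - q) m = - stein_sol e q m.
Proof. by case: m => [[|k]|k]//=; rewrite ?oppr0// sumrB; ring. Qed.

Let fdiff_stein_sol_le e q m : admissible e q -> fdiff (stein_sol e q) m <= lam^-1.
Proof.
move=> [He Hq].
have l0 : 0 <= lam^-1 by rewrite invr_ge0 ltW.
rewrite /fdiff; case: m => [[|k]|k].
- rewrite add0r/= subr0 !big_ord1 ler_pdivrMr ?mulr_gt0// mulKf ?gt_eqF//.
  have := He 0%N; have := Hq 0%N; rewrite !big_ord1 => h1 h2.
  have := p0 0; have : 0 <= q * p 0 by rewrite mulr_ge0//; lra.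
  lra.
- rewrite -PoszD addn1 /= -subr_ge0.
  set F := \sum_(j < k.+1) e j; set c := C k; set p1 := p k.+1.
  have -> : \sum_(j < k.+2) e j = F + e k.+1 by rewrite big_ord_recr.
  have -> : \sum_(j < k.+2) p j = c + p1 by rewrite big_ord_recr.
  have F0 : 0 <= F by apply: sumr_ge0 => j _; have /andP[] := He j.
  have := Hq k.+1; rewrite CS big_ord_recr/= -/F -/c -/p1 => /andP[G0 _].
  have e1 : 0 <= p1 - e k.+1 by have := He k.+1; rewrite -/p1; lra.
  have D1 : 0 <= (1 - c) * p1 - (1 - (c + p1)) * p k.
    by have := T_step k; rewrite CS -/c -/p1; lra.
  have D2 : 0 <= (c + p1) * p k - c * p1.
    by have := C_step k; rewrite CS -/c -/p1; lra.
  have D4 : 0 <= p k * (1 - (c + p1)) + c * p1.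
    rewrite addr_ge0 ?mulr_ge0//.
    - by rewrite subr_ge0 -CS.
    - exact: C_ge0.
    - exact: p0.
  have p1p : 0 < p1 by exact: p_gt0.
  (* The gap to 1/lam is a nonnegative combination: the mass before [k.+1], the mass after it and
     the complementary mass at it, each times a nonnegative factor, plus one more nonnegative
     term. *)
  have -> : lam^-1 - ((F + e k.+1 - q * (c + p1)) / (lam * p1) -
     (F - q * c) / (lam * p k)) =
     (p1 * (p k * (c + p1) - c * p1) + F * ((1 - c) * p1 - (1 - (c + p1)) * p k)
      + (q - (F + e k.+1)) * ((c + p1) * p k - c * p1)
      + (p1 - e k.+1) * (p k * (1 - (c + p1)) + c * p1)) / (lam * p1 * p k).
    by field; rewrite !gt_eqF.
  apply: divr_ge0; last by rewrite !mulr_ge0// ltW.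
  have : 0 <= F * ((1 - c) * p1 - (1 - (c + p1)) * p k) by rewrite mulr_ge0.
  have : 0 <= (q - (F + e k.+1)) * ((c + p1) * p k - c * p1) by rewrite mulr_ge0.
  have : 0 <= (p1 - e k.+1) * (p k * (1 - (c + p1)) + c * p1) by rewrite mulr_ge0.
  have : 0 <= p1 * (p k * (c + p1) - c * p1).
    by apply: mulr_ge0; [exact: p0 | lra].
  lra.
- by rewrite !stein_sol_neg ?subrr//; lia.
Qed.

(** The solution for the complement is the negative one, so the upper bound gives the lower bound
    too. *)
Lemma fdiff_stein_sol e q m :
  admissible e q -> `|fdiff (stein_sol e q) m| <= lam^-1.
Proof.
move=> H; rewrite ler_norml fdiff_stein_sol_le// andbT.
have := fdiff_stein_sol_le m (admissibleC H).
by rewrite /fdiff !stein_solC; lra.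
Qed.

(** At [k.+1] the numerator is p_a (1 - C k) if a <= k and -p_a C k otherwise. Monotonicity of (1 -
    C)/p, respectively C/p, reduces both cases to [k] next to [a], the second ending with
    [C_lam]. *)
Lemma stein_sol_point a m :
  `|stein_sol (fun k => (k == a)%:R * p a) (p a) m| <= lam^-1.
Proof.
have l0 : 0 <= lam^-1 by rewrite invr_ge0 ltW.
case: m => [[|k]|k] /=; rewrite ?normr0//.
have lp : 0 < lam * p k by rewrite mulr_gt0.
rewrite normrM [`|(_ * _)^-1|]gtr0_norm ?invr_gt0// ler_pdivrMr// mulKf ?gt_eqF//.
have sumE : \sum_(j < k.+1) (j == a :> nat)%:R * p a = (a <= k)%N%:R * p a.
  rewrite -mulr_suml -natr_sum; congr (_%:R * _).
  have [ak|ka] := leqP a k.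
    rewrite (bigD1 (Ordinal (ltac:(lia) : a < k.+1)%N))//= eqxx big1 ?addn0//.
    by move=> j /negPf; rewrite -val_eqE/= => ->.
  by rewrite big1// => j _; have := ltn_ord j; case: eqP => //; lia.
rewrite sumE; have [ak|ka] := leqP a k.
  have T_mono : nonincreasing_seq (fun k => (1 - C k) / p k).
    by apply/nonincreasing_seqP => j; rewrite ler_pdivrMr// mulrAC ler_pdivlMr.
  have := T_mono _ _ ak; rewrite ler_pdivrMr// mulrAC ler_pdivlMr// => H.
  rewrite mul1r -{1}[p a]mulr1 -mulrBr ger0_norm ?mulr_ge0 ?subr_ge0 ?C_le1//.
  rewrite mulrC; apply: le_trans H _.
  by rewrite -[leRHS]mul1r ler_wpM2r// lerBlDl lerDr.
have C_mono : nondecreasing_seq (fun k => C k / p k).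
  by apply/nondecreasing_seqP => j; rewrite ler_pdivrMr// mulrAC ler_pdivlMr.
rewrite [false%:R * _]mul0r sub0r normrN ger0_norm ?mulr_ge0 ?C_ge0//.
case: a ka {sumE} => // a ka.
have := C_mono _ _ (ltac:(lia) : (k <= a)%N).
rewrite ler_pdivrMr// mulrAC ler_pdivlMr// => H.
rewrite -(@ler_pM2l _ a.+1%:R) ?ltr0n// mulrA pS -mulrA (mulrC (p a)).
apply: (@le_trans _ _ (lam * (C a * p k))); first by apply: ler_wpM2l => //; exact: ltW.
rewrite mulrA; apply: (@le_trans _ _ (a.+1%:R * C a.+1 * p k)).
  by rewrite ler_wpM2r.
by rewrite ler_wpM2r// -[leRHS]mulr1 ler_wpM2l.
Qed.

End PoissonStein.

(** * Distances to the translated Poisson law *)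

Section SteinMethod.
Local Open Scope classical_set_scope.
Context {R : realType} {n : nat} (a : 'M[int]_n) (K : nat).
Local Notation W := (perm_sum a).
Local Notation pmean := (@pmean R n).
Let Wr s : R := (W s)%:~R.
Let mu : R := pmean Wr.
Let V : R := pmean (fun s => (Wr s - mu) ^+ 2).
Hypothesis jumpK : forall (t : 'S_n) (S : {set 'I_n}),
  (#|S| <= 4)%N -> perm_on S t -> forall s, `|jump a t s| <= K.
Variables (lam : R) (p : nat -> R) (s0 : int) (b : int -> R) (q : R).
Hypotheses (lam0 : 0 < lam) (p_gt0 : forall k, 0 < p k).
Hypothesis pS : forall k, k.+1%:R * p k.+1 = lam * p k.
Hypothesis p1 : (fun k => \sum_(j < k.+1) p j) @ \oo --> (1 : R).
Hypotheses (V0 : 0 < V) (lamE : lam + s0%:~R = mu) (Vlam : V <= lam <= V + 1).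
Hypothesis b01 : forall m, 0 <= b m <= 1.
Let e k := b (s0 + k%:Z) * p k.
Hypothesis eq_adm : admissible p e q.
Let g (m : int) : R := stein_sol lam p e q (m - s0).
Variable eps : R.
Hypothesis smooth : forall (S : {set 'I_n}) (psi : 'S_n -> R) (B : R) (m : int),
  (#|S| <= 4)%N -> dep_on S psi -> (forall s, `|psi s| <= B) ->
  `|pmean (fun s => psi s * fdiff (fdiff g) (W s + m))| <= B * eps.

Let q01 : 0 <= q <= 1.
Proof.
have [H1 H2] := eq_adm; have := H1 0%N; have := H2 0%N; rewrite !big_ord1; lra.
Qed.

Let fdiff_g m : `|fdiff g m| <= lam^-1.
Proof.
have -> : fdiff g m = fdiff (stein_sol lam p e q) (m - s0).
  by rewrite /fdiff /g; congr (stein_sol _ _ _ _ _ - _); ring.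
exact: fdiff_stein_sol.
Qed.

Let stein_eq m : s0 <= m ->
  b m - q = lam * g (m + 1) - (m - s0)%:~R * g m.
Proof.
move=> sm; have [k mE] : exists k : nat, m - s0 = k%:Z by exists `|m - s0|%N; lia.
have -> : m = s0 + k%:Z by rewrite -mE; ring.
rewrite /g; have -> : s0 + k%:Z + 1 - s0 = k%:Z + 1 by ring.
have -> : s0 + k%:Z - s0 = k%:Z by ring.
by rewrite -[k%:~R]/(k%:R) stein_sol_eq// /e mulfK// gt_eqF.
Qed.

(** The Stein-Chen equation holds exactly from [s0] on. Below [s0] the solution vanishes and the
    error is at most 1, but there [m] is more than [lam] away from the mean. *)
Let stein_err m : `|b m - q - (lam * g (m + 1) - (m - s0)%:~R * g m)|
  <= (m%:~R - mu) ^+ 2 / lam ^+ 2.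
Proof.
have l2 : 0 < lam ^+ 2 by rewrite exprn_gt0.
have [sm|ms] := leP s0 m.
  by rewrite stein_eq// subrr normr0 divr_ge0 ?sqr_ge0.
rewrite /g !stein_sol_neg; [|lia..].
rewrite !mulr0 !subr0; apply: (@le_trans _ _ 1).
  by rewrite ler_norml; have := b01 m; have := q01; lra.
rewrite ler_pdivlMr// mul1r -lamE.
have : m%:~R + 1 <= s0%:~R :> R by rewrite -[1]/(1%:~R) -intrD ler_int; lia.
set x : R := m%:~R; set y : R := s0%:~R => xy.
by rewrite -[leRHS]sqrrN; apply: lerXn2r; rewrite ?nnegrE; move: (lam0) xy; lra.
Qed.

(** One 1/V is the Chebyshev cost of falling below [s0]; the other is |lam - V| <= 1 times the bound
    1/lam on [fdiff g]. The last term comes from [stein_exchangeable]. *)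
Lemma poisson_stein_bound :
  `|pmean (fun s => b (W s)) - q| <= 2 / V + 2 * n%:R * K%:R ^+ 3 * eps.
Proof.
have [Vl lV] := andP Vlam.
have lamV : lam^-1 <= V^-1 by rewrite lef_pV2 ?posrE.
pose Z s := lam * g (W s + 1) - (W s - s0)%:~R * g (W s).
have H1 : `|pmean (fun s => b (W s) - q - Z s)| <= V^-1.
  apply: le_trans (ler_norm_pmean _) _.
  apply: (@le_trans _ _ (pmean (fun s => (Wr s - mu) ^+ 2 / lam ^+ 2))).
    by apply: ler_pmean => s; exact: stein_err.
  rewrite pmeanZr -/V; apply: le_trans lamV.
  rewrite ler_pdivrMr ?exprn_gt0// expr2 mulKf ?gt_eqF//.
have H2 : pmean Z = (lam - V) * pmean (fun s => fdiff g (W s))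
  - (pmean (fun s => (Wr s - mu) * g (W s)) - V * pmean (fun s => fdiff g (W s))).
  rewrite mulrBl opprB addrA subrK -pmeanZ -pmeanB; apply: eq_pmean => s.
  rewrite /Z /fdiff /Wr intrB -lamE; ring.
have H3 := stein_exchangeable jumpK smooth.
have H4 : `|pmean (fun s => fdiff g (W s))| <= lam^-1.
  apply: le_trans (ler_norm_pmean _) _; rewrite -[leRHS](@pmean_cst R n).
  exact: ler_pmean.
have -> : pmean (fun s => b (W s)) - q = pmean (fun s => b (W s) - q - Z s) + pmean Z.
  by rewrite !pmeanB pmean_cst; ring.
apply: le_trans (ler_normD _ _) _; rewrite H2.
have : `|(lam - V) * pmean (fun s => fdiff g (W s)) -
    (pmean (fun s => (Wr s - mu) * g (W s)) - V * pmean (fun s => fdiff g (W s)))|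
    <= V^-1 + 2 * n%:R * K%:R ^+ 3 * eps.
  apply: le_trans (ler_normB _ _) _; apply: lerD; last exact: H3.
  rewrite normrM -[leRHS]mul1r; apply: ler_pM => //; last exact: le_trans lamV.
  by rewrite ler_norml; lra.
by lra.
Qed.

End SteinMethod.

(** * Smoothing rates from the unit-jump assumption *)

Section SmoothingRates.
Context {R : realType} {n : nat} (a : 'M[int]_n) (alpha1 alpha2 : R).
Local Notation W := (perm_sum a).
Local Notation pmean := (@pmean R n).
Hypotheses (a10 : 0 < alpha1) (a20 : 0 < alpha2) (n0 : (0 < n)%N).
Hypothesis H2 : assumption2 a alpha1 alpha2.

Definition smoothing_cst : R := (16 / alpha2 ^+ 2 + 2 / alpha2) / alpha1.

Lemma smoothing_cst_ge0 : 0 <= smoothing_cst.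
Proof. by rewrite divr_ge0 ?addr_ge0 ?divr_ge0 ?sqr_ge0 ?ltW. Qed.

(** The default 1 makes [perm_on e (swap e)] hold for every set [e], pair or not. *)
Let swap (e : {set 'I_n}) : 'S_n :=
  if [pick xy : 'I_n * 'I_n | (xy.1 != xy.2) && (e == [set xy.1; xy.2])] is Some xy
  then tperm xy.1 xy.2 else 1%g.

Let swap_on e : perm_on e (swap e).
Proof.
rewrite /swap; case: pickP => [[x y]/= /andP[_ /eqP->]|_]; last exact: perm_on1.
apply/fintype.subsetP => z; rewrite !inE.
by case: tpermP => [->|->|]//; rewrite eqxx ?orbT.
Qed.

Lemma exists_smoothing : exists N : 'S_n -> nat,
  pmean (fun s => (N s).+1%:R^-1) <= smoothing_cst / n%:R /\
  forall (S : {set 'I_n}) (psi : 'S_n -> R) (H : int -> R) (B : R) (beta : nat -> R),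
    (#|S| <= 4)%N -> dep_on S psi -> (forall s, `|psi s| <= B) ->
    (forall k m, `|avgn k H m| <= beta k) ->
    (forall k l, (k <= l)%N -> beta l <= beta k) ->
    `|pmean (fun s => psi s * H (W s))| <= B * pmean (fun s => beta (N s - 4)%N).
Proof.
have [I [/fintype.subsetP Ipairs tI cI HI]] := H2.
have unit_jump e : e \in I -> exists i j,
  [/\ i != j, e = [set i; j], swap e = tperm i j &
   alpha2 <= pmean (fun s => (`|jump a (swap e) s| == 1)%:R)].
  move=> eI; have := Ipairs _ eI; rewrite inE => /cards2P[x [y [xy eE]]].
  rewrite /swap; case: pickP => [[i j]/= /andP[ij /eqP eE']|/(_ (x, y))]; last first.
    by rewrite /= xy eE eqxx.
  exists i, j; split => //.
  have [J [/fintype.subsetP Jpairs cJ HJ]] : exists J : {set {set 'I_n}},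
      [/\ J \subset pairs n, alpha2 * n%:R ^+ 2 <= #|J|%:R & forall j1 j2 : 'I_n,
        [set j1; j2] \in J -> `|a i j1 + a j j2 - a i j2 - a j j1| = 1].
    by apply: HI; rewrite -eE'.
  pose q k l : R := (`|a i l + a j k - a i k - a j l| == 1)%:R.
  rewrite (eq_pmean (G := fun s => q (s i) (s j))) => [|s]; last by rewrite jump_tperm.
  apply: le_trans (pmean_pair_ge ij (q := q) _); last by move=> k l; exact: ler0n.
  rewrite ler_pdivlMr ?exprn_gt0 ?ltr0n//; apply: le_trans cJ _.
  rewrite pair_big_dep/=.
  pose D := [set xy : 'I_n * 'I_n | (xy.1 != xy.2) && ([set xy.1; xy.2] \in J)].
  (* Each unordered pair of [J] comes from some ordered pair in [D]. *)
  apply: (@le_trans _ _ #|D|%:R).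
    rewrite ler_nat.
    apply: leq_trans (leq_imset_card (fun xy : 'I_n * 'I_n => [set xy.1; xy.2]) D).
    apply: subset_leq_card; apply/fintype.subsetP => f fJ.
    have := Jpairs _ fJ; rewrite inE => /cards2P[k [l [kl fE]]].
    by apply/imsetP; exists (k, l); rewrite ?inE/= -?fE ?kl.
  rewrite -sum1_card natr_sum [leRHS]big_mkcond [leLHS]big_mkcond/=.
  apply: ler_sum => -[k l] _; rewrite inE/=.
  case: (k != l) => //=; case: ifP => [kl|_]; last exact: ler0n.
  (* The jump is minus the mixed difference of the assumption. *)
  rewrite /q (_ : a i l + a j k - a i k - a j l = - (a i k + a j l - a i l - a j k)).
    by rewrite normrN HJ.
  by ring.
exists (nb_unit_jumps a swap (enum I)); split; last first.
  move=> S psi H B beta S4 dpsi psiB Hb bd.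
  exact: (pmean_smooth_unit a swap_on tI S4 dpsi psiB Hb bd).
have I0 : 0 < #|I|%:R :> R by apply: lt_le_trans cI; rewrite mulr_gt0 ?ltr0n.
apply: le_trans (pmean_inv_unit_jumps swap_on tI unit_jump a20 _) _.
  by rewrite -(ltr0n R).
have -> : smoothing_cst / n%:R = (16 / alpha2 ^+ 2 + 2 / alpha2) / (alpha1 * n%:R).
  by rewrite /smoothing_cst; set X := _ + _; rewrite [(alpha1 * _)^-1]invfM mulrA.
rewrite ler_wpM2l ?addr_ge0 ?divr_ge0 ?sqr_ge0 ?(ltW a20)//.
by rewrite lef_pV2 ?posrE// mulr_gt0// ltr0n.
Qed.

End SmoothingRates.

(** * The Poisson law as an instance *)

Section PoissonInstance.
Local Open Scope classical_set_scope.
Context {R : realType} (lam : R).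
Hypothesis lam0 : 0 < lam.
Local Notation p := (poisson_pmf lam).
Local Notation Q := (poisson_prob lam 0).

Lemma poisson_pmf_gt0 k : 0 < p k.
Proof.
by rewrite /poisson_pmf lam0 mulr_gt0 ?expR_gt0// divr_gt0 ?exprn_gt0// ltr0n fact_gt0.
Qed.

Lemma poisson_pmfS k : k.+1%:R * p k.+1 = lam * p k.
Proof.
rewrite /poisson_pmf lam0 factS natrM exprS; field.
by rewrite nat1r !pnatr_eq0 /= -lt0n fact_gt0.
Qed.

Let Q1 k : Q [set k] = (p k)%:E.
Proof. by rewrite /poisson_prob lam0 esum_set1// lee_fin poisson_pmf_ge0. Qed.

Let finQ A : Q A \is a fin_num.
Proof. exact: fin_num_measure. Qed.

Let QI A k : fine (Q (A `&` `I_k)) = \sum_(j < k) (nat_of_ord j \in A)%:R * p j.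
Proof.
elim: k => [|k IH]; first by rewrite II0 setI0 measure0 big_ord0.
rewrite big_ord_recr/= -IH IIS setIUr measureU//; last first.
  by apply/seteqP; split => // x [[_ /= xk] [_ /= xE]]; move: xk; rewrite xE ltnn.
rewrite fineD ?finQ//; congr (_ + _).
have [kA|kA] := boolP (k \in A).
  rewrite mul1r -[p k]/(fine (p k)%:E) -Q1; congr (fine (Q _)).
  by apply/seteqP; split => x /=; [case | move=> ->; split => //; exact: set_mem].
rewrite mul0r (_ : A `&` [set k] = set0) ?measure0//.
by apply/seteqP; split => // x [/= Ax xk]; move/negP: kA; apply; rewrite -xk; exact: mem_set.
Qed.

Lemma poisson_pmf_sum k : \sum_(j < k) p j = fine (Q `I_k).
Proof.
by rewrite -[`I_k]setTI QI; apply: eq_bigr => j _; rewrite mem_set// mul1r.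
Qed.

Lemma poisson_pmf_cvg : (fun k => \sum_(j < k.+1) p j) @ \oo --> (1 : R).
Proof.
have -> : (fun k => \sum_(j < k.+1) p j) = (fun k => fine (Q `I_k.+1)).
  by apply/funext => k; rewrite poisson_pmf_sum.
have -> : 1 = fine (Q (\bigcup_k `I_k.+1)).
  rewrite (_ : \bigcup_k `I_k.+1 = setT) ?probability_setT//.
  by apply/seteqP; split => // x _; exists x => /=.
apply: fine_cvg; rewrite fineK//.
apply: nondecreasing_cvg_mu => //.
by move=> k l kl; apply/subsetPset => x /= xk; apply: leq_trans xk _.
Qed.

Lemma poisson_admissible (A : set nat) :
  admissible p (fun k => (k \in A)%:R * p k) (fine (Q A)).
Proof.
split=> k.
  by have := poisson_pmf_ge0 lam k; case: (_ \in _); rewrite ?mul1r ?mul0r lexx => ->.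
have Q_split (B : set nat) : fine (Q B) = fine (Q (B `&` `I_k.+1)) + fine (Q (B `\` `I_k.+1)).
  by rewrite -fineD ?finQ// addeC -measureDI.
rewrite -QI poisson_pmf_sum; have := Q_split A; have := Q_split setT.
rewrite setTI probability_setT [fine 1%E]/= setTD => hT hA.
have u0 : 0 <= fine (Q (A `\` `I_k.+1)) by rewrite fine_ge0.
have uv : fine (Q (A `\` `I_k.+1)) <= fine (Q (~` `I_k.+1)).
  by rewrite fine_le ?finQ// le_measure ?inE// => x [].
lra.
Qed.

Lemma fine_poisson_prob1 k : fine (Q [set k]) = p k.
Proof. by rewrite Q1. Qed.

End PoissonInstance.

(** * Bounds for a fixed matrix, for each set and each point *)

Section FixedSize.
Local Open Scope classical_set_scope.
Context {R : realType} {n : nat} (a : 'M[int]_n) (A : nat) (alpha1 alpha2 : R).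
Local Notation W := (perm_sum a).
Local Notation pmean := (@pmean R n).
Let Wr s : R := (W s)%:~R.
Let mu : R := pmean Wr.
Let V : R := pmean (fun s => (Wr s - mu) ^+ 2).
Hypotheses (a10 : 0 < alpha1) (a20 : 0 < alpha2) (n0 : (0 < n)%N).
Hypothesis aA : forall i j, `|a i j| <= A%:Z.
Hypothesis H2 : assumption2 a alpha1 alpha2.
Hypothesis V0 : 0 < V.
Local Notation K := (8 * A)%N.
Local Notation kappa := (smoothing_cst alpha1 alpha2).

Let s0 : int := Num.floor (mu - V).
(** Equal to mu - s0, but written to match the Poisson parameter in [translated_poisson] by
    conversion. *)
Let lam : R := V + (mu - V - s0%:~R).
Local Notation p := (poisson_pmf lam).

Let lamV : V <= lam <= V + 1.
Proof.
rewrite /lam lerDl subr_ge0 ge_floor/= lerD2l lerBlDl.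
by have := floorD1_gt (mu - V); rewrite intrD => /ltW.
Qed.

Let lam0 : 0 < lam. Proof. by case/andP: lamV => + _; apply: lt_le_trans. Qed.

Let jumpK (t : 'S_n) (S : {set 'I_n}) : (#|S| <= 4)%N -> perm_on S t ->
  forall s, `|jump a t s| <= K%:Z.
Proof.
move=> S4 tS s; apply: le_trans (jump_le aA s tS) _.
by rewrite lez_nat (_ : 8 * A = 2 * A * 4)%N ?leq_mul//; lia.
Qed.

Let b (B : set int) (m : int) : R := (m \in B)%:R.
Let e B k := b B (s0 + k%:Z) * p k.
Let q B := fine (translated_poisson mu V B).

Let e_admissible B : admissible p (e B) (q B).
Proof. exact: poisson_admissible. Qed.

Let tp_bound B eps :
  (forall (S : {set 'I_n}) (psi : 'S_n -> R) (c : R) (m : int),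
    (#|S| <= 4)%N -> dep_on S psi -> (forall s, `|psi s| <= c) ->
    `|pmean (fun s => psi s * fdiff (fdiff
        (fun m => stein_sol lam p (e B) (q B) (m - s0))) (W s + m))| <= c * eps) ->
  `|pmean (fun s => b B (W s)) - q B| <= 2 / V + 2 * n%:R * K%:R ^+ 3 * eps.
Proof.
apply: (poisson_stein_bound jumpK lam0 (poisson_pmf_gt0 lam0) (poisson_pmfS lam0)
  (poisson_pmf_cvg lam0) V0 _ lamV _ (e_admissible B)).
- by rewrite /lam -/mu; ring.
- by move=> m; rewrite /b; case: (_ \in _); rewrite lexx ler01.
Qed.

(** The factor 5 is attained at N = 4, where the left side is 1. *)
Let inv_shift (N : 'S_n -> nat) s : (N s - 4).+1%:R^-1 <= 5 * (N s).+1%:R^-1 :> R.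
Proof.
rewrite -[_^-1]mul1r ler_pdivrMr ?ltr0n// mulrAC ler_pdivlMr ?ltr0n// mul1r.
by rewrite -natrM ler_nat; lia.
Qed.

(** One difference is spent on the bound 1/lam for [fdiff g] and the other is smoothed, so eps has
    order 1/(V sqrt n). *)
Lemma dTV_pointwise B :
  `|pmean (fun s => b B (W s)) - q B|
  <= 2 / V + 2 * K%:R ^+ 3 * (1 + 5 * kappa) * Num.sqrt n%:R / V.
Proof.
have [N [EN smooth]] := exists_smoothing a10 a20 n0 H2.
have nR : 0 < n%:R :> R by rewrite ltr0n.
set r := Num.sqrt n%:R.
have r0 : 0 < r by rewrite sqrtr_gt0.
have rE : r ^+ 2 = n%:R by rewrite sqr_sqrtr ?ltW.
set eps := (1 + 5 * kappa) / (V * r).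
have -> : 2 * K%:R ^+ 3 * (1 + 5 * kappa) * r / V = 2 * n%:R * K%:R ^+ 3 * eps.
  by rewrite /eps -rE; field; rewrite !gt_eqF.
apply: tp_bound => S psi c m S4 dpsi psic.
have c0 : 0 <= c by apply: le_trans (psic 1%g).
set g := fun m : int => _.
pose h k := fdiff g (k + m).
have hE k : fdiff (fdiff g) (k + m) = fdiff h k.
  by rewrite -[RHS]/(fdiff g (k + 1 + m) - fdiff g (k + m)) (addrAC k 1 m).
rewrite (eq_pmean (G := fun s => psi s * fdiff h (W s))) => [|s]; last by rewrite hE.
have hb k : `|h k| <= lam^-1.
  have -> : h k = fdiff (stein_sol lam p (e B) (q B)) (k + m - s0).
    by rewrite /h /fdiff /g; congr (stein_sol _ _ _ _ _ - _); ring.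
  by apply: (fdiff_stein_sol lam0 (poisson_pmf_gt0 lam0) (poisson_pmfS lam0)
    (poisson_pmf_cvg lam0)).
pose beta k := 2 * lam^-1 / Num.sqrt k.+1%:R.
have lam1 : 0 <= lam^-1 by rewrite invr_ge0 ltW.
apply: le_trans (smooth S psi (fdiff h) c beta S4 dpsi psic _ _) _.
- by move=> k l; exact: avgn_diff_bound.
- move=> k l kl; rewrite /beta ler_wpM2l ?mulr_ge0// lef_pV2 ?posrE ?sqrtr_gt0//.
  by rewrite ler_sqrt ?ler_nat.
apply: ler_wpM2l => //.
apply: (@le_trans _ _ (pmean (fun s => lam^-1 * (r^-1 + 5 * r * (N s).+1%:R^-1)))).
  apply: ler_pmean => s; rewrite /beta.
  set z := Num.sqrt _.
  have z0 : 0 < z by rewrite sqrtr_gt0.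
  have zE : z ^+ 2 = (N s - 4).+1%:R by rewrite sqr_sqrtr.
  rewrite -mulrA mulrCA ler_wpM2l//.
  (* By 2/z <= 1/r + r/z^2 with r = sqrt n, the mean of 1/(N + 1) also controls the inverse square
     root. *)
  apply: (@le_trans _ _ (r^-1 + r * (z ^+ 2)^-1)); last first.
    by rewrite lerD2l [5 * r]mulrC -mulrA ler_wpM2l ?(ltW r0)// zE inv_shift.
  have -> : r^-1 + r * (z ^+ 2)^-1 = (z ^+ 2 + r ^+ 2) / (r * z ^+ 2).
    by field; rewrite !gt_eqF.
  rewrite ler_pdivrMr// mulrAC ler_pdivlMr ?mulr_gt0 ?exprn_gt0//.
  have -> : 2 * (r * z ^+ 2) = z * (2 * r * z) by ring.
  rewrite mulrC ler_wpM2r ?(ltW z0)//.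
  by have := sqr_ge0 (r - z); lra.
rewrite pmeanZ pmeanD pmean_cst pmeanZ.
have lV : lam^-1 <= V^-1 by rewrite lef_pV2 ?posrE//; case/andP: lamV.
have -> : eps = V^-1 * (r^-1 + 5 * r * (kappa / n%:R)).
  by rewrite /eps -rE; field; rewrite !gt_eqF.
apply: ler_pM => //.
  apply: addr_ge0; first by rewrite invr_ge0 ltW.
  apply: mulr_ge0; first by rewrite mulr_ge0// ltW.
  by apply: pmean_ge0 => s; rewrite invr_ge0.
by rewrite lerD2l ler_wpM2l// mulr_ge0// ltW.
Qed.

(** For a point the solution itself is at most 1/lam, so both differences are smoothed and eps has
    order 1/(V n). The 80 is 2 from [poisson_stein_bound], 8 from [avgn_diff2_bound] and 5 from
    [inv_shift]. *)
Lemma dloc_pointwise k :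
  `|pmean (fun s => b [set k] (W s)) - q [set k]| <= (2 + 80 * K%:R ^+ 3 * kappa) / V.
Proof.
have [N [EN smooth]] := exists_smoothing a10 a20 n0 H2.
have nR : 0 < n%:R :> R by rewrite ltr0n.
set eps := 40 * kappa / (V * n%:R).
have -> : (2 + 80 * K%:R ^+ 3 * kappa) / V = 2 / V + 2 * n%:R * K%:R ^+ 3 * eps.
  by rewrite /eps; field; rewrite !gt_eqF.
apply: tp_bound => S psi c m S4 dpsi psic.
have c0 : 0 <= c by apply: le_trans (psic 1%g).
have lam1 : 0 <= lam^-1 by rewrite invr_ge0 ltW.
set g := fun m : int => _.
have gb l : `|g l| <= lam^-1.
  (* A point below [s0] carries no translated Poisson mass, and its solution is zero. *)
  rewrite /g; have [ks|sk] := ltP k s0.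
    have -> : stein_sol lam p (e [set k]) (q [set k]) = fun=> 0.
      apply/funext => -[[|x]|x] //=.
      rewrite /q /translated_poisson /pushforward -/s0 -/lam.
      rewrite (_ : _ @^-1` [set k] = set0) ?measure0 ?mul0r ?subr0; last first.
        by apply/seteqP; split => // j /= jk; lia.
      rewrite big1 ?mul0r// => j _; rewrite /e /b memNset ?mul0r//= => jk; lia.
    by rewrite normr0.
  have [j kE] : exists j : nat, k = s0 + j%:Z by exists `|k - s0|%N; lia.
  have -> : e [set k] = fun i => (i == j)%:R * p j.
    apply/funext => i; rewrite /e /b kE; have [->|ij] := eqVneq i j.
      by rewrite mem_set.
    by rewrite memNset ?mul0r//= => /addrI[/eqP]; rewrite (negPf ij).
  have -> : q [set k] = p j.
    rewrite /q /translated_poisson /pushforward -/s0 -/lam -(fine_poisson_prob1 lam0).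
    congr (fine (poisson_prob _ _ _)); apply/seteqP; split => i /=; rewrite kE.
      by move=> /addrI[].
    by move=> ->.
  by apply: (stein_sol_point lam0 (poisson_pmf_gt0 lam0) (poisson_pmfS lam0)
    (poisson_pmf_cvg lam0)).
pose h l := g (l + m).
have hE l : fdiff (fdiff g) (l + m) = fdiff (fdiff h) l.
  by rewrite /fdiff /h; congr (g _ - g _ - (g _ - g _)); ring.
rewrite (eq_pmean (G := fun s => psi s * fdiff (fdiff h) (W s))) => [|s]; last by rewrite hE.
pose beta k := 8 * lam^-1 / k.+1%:R.
apply: le_trans (smooth S psi (fdiff (fdiff h)) c beta S4 dpsi psic _ _) _.
- by move=> i l; apply: avgn_diff2_bound => x; exact: gb.
- move=> i l il; rewrite /beta ler_wpM2l ?mulr_ge0// lef_pV2 ?posrE ?ltr0n//.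
  by rewrite ler_nat.
apply: ler_wpM2l => //.
apply: (@le_trans _ _ (pmean (fun s => 40 * lam^-1 * (N s).+1%:R^-1))).
  apply: ler_pmean => s; rewrite /beta.
  have -> : 40 * lam^-1 * (N s).+1%:R^-1 = 8 * lam^-1 * (5 * (N s).+1%:R^-1) by ring.
  by rewrite ler_wpM2l ?mulr_ge0// inv_shift.
rewrite pmeanZ.
have lV : lam^-1 <= V^-1 by rewrite lef_pV2 ?posrE//; case/andP: lamV.
have -> : eps = 40 * V^-1 * (kappa / n%:R).
  by rewrite /eps; field; rewrite !gt_eqF.
apply: ler_pM => //; first by rewrite mulr_ge0.
  by apply: pmean_ge0 => s; rewrite invr_ge0.
by rewrite ler_wpM2l.
Qed.

End FixedSize.

(** * From the random permutation to means over the symmetric group *)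

Section UniformPermutation.
Local Open Scope classical_set_scope.
Context {R : realType} (d : measure_display) (T : measurableType d).
Context (P : probability T R) (n : nat) (rho : T -> 'S_n).
Hypothesis rhoP : uniform_permutation P rho.

Let measurable_rho s : measurable (rho @^-1` [set s]).
Proof. by have [] := rhoP s. Qed.

Lemma expectation_uniform_permutation (F : 'S_n -> R) :
  ('E_P[fun w => F (rho w)] = (pmean F)%:E)%E.
Proof.
rewrite unlock.
rewrite (eq_integral (fun w => \sum_(s : 'S_n)
  ((F s)%:E * (\1_(rho @^-1` [set s]) w)%:E)%E)%E); last first.
  move=> w _; rewrite (bigD1 (rho w))//= big1 ?adde0 => [|s /negPf sw].
    by rewrite indicE mem_set// mule1.
  by rewrite indicE memNset ?mule0//= => ws; rewrite -ws eqxx in sw.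
rewrite integral_sum//; last first.
  by move=> s; apply: integrableZl => //; exact: integrable_indic.
rewrite /pmean mulr_sumr -sumEFin; apply: eq_bigr => s _.
rewrite integralZl//; last exact: integrable_indic.
rewrite integral_indic// setIT mulrC EFinM; congr (_ * _)%E.
exact: (rhoP s).2.
Qed.

Context (a : 'M[int]_n).
Local Notation W := (fun w => perm_sum a (rho w)).

Lemma mean_perm_sum : mean P W = pmean (fun s => (perm_sum a s)%:~R).
Proof. by rewrite /mean (expectation_uniform_permutation (fun s => (perm_sum a s)%:~R)). Qed.

Lemma var_perm_sum :
  var P W = pmean (fun s => ((perm_sum a s)%:~R - mean P W) ^+ 2).
Proof.
have -> : var P W = fine ('E_P[fun w => (((perm_sum a (rho w))%:~R - mean P W) ^+ 2)%R])%E.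
  by rewrite /var /variance unlock.
by rewrite (expectation_uniform_permutation (fun s => ((perm_sum a s)%:~R - mean P W) ^+ 2)).
Qed.

Lemma law_perm_sum (B : set int) :
  fine (law P W B) = pmean (fun s => (perm_sum a s \in B)%:R).
Proof.
have mB : measurable (W @^-1` B).
  rewrite (_ : W @^-1` B = \big[setU/set0]_(s : 'S_n | perm_sum a s \in B)
    (rho @^-1` [set s])).
    by apply: bigsetU_measurable => s _.
  rewrite -bigcup_seq_cond; apply/seteqP; split => w /=.
    by move=> Bw; exists (rho w) => //=; rewrite mem_index_enum mem_set.
  by case=> s /= /andP[_ /set_mem Bs] ->.
rewrite /law /pushforward -expectation_indic//.
by rewrite -[in LHS](_ : (fun w => (perm_sum a (rho w) \in B)%:R) = \1_(W @^-1` B))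
  ?(expectation_uniform_permutation (fun s => (perm_sum a s \in B)%:R)).
Qed.

End UniformPermutation.

(** * Suprema of bounded families *)

Section Suprema.
Local Open Scope classical_set_scope.

Lemma sup_norm_image_le {R : realType} (I : pointedType) (f : I -> R) (c : R) :
  (forall i, `|f i| <= c) -> `|sup [set `|f i| | i in [set: I]]| <= c.
Proof.
move=> fc; have ne : [set `|f i| | i in [set: I]] !=set0 by exists `|f point|, point.
have ub : ubound [set `|f i| | i in [set: I]] c by move=> _ [i _ <-].
rewrite ger0_norm; first exact: ge_sup.
by apply: le_trans (normr_ge0 (f point)) _; apply: ub_le_sup; [exists c | exists point].
Qed.

End Suprema.

(** * Distance bounds for a fixed number of indices *)

Section Distances.
Local Open Scope classical_set_scope.
Context {R : realType} (d : measure_display) (T : measurableType d).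
Context (P : probability T R) (n : nat) (rho : T -> 'S_n).
Hypothesis rhoP : uniform_permutation P rho.
Context (a : 'M[int]_n) (A : nat) (alpha1 alpha2 : R).
Local Notation W := (fun w => perm_sum a (rho w)).
Local Notation V := (var P W).
Local Notation TP := (translated_poisson (mean P W) V).
Hypotheses (a10 : 0 < alpha1) (a20 : 0 < alpha2) (n0 : (0 < n)%N).
Hypothesis aA : forall i j, `|a i j| <= A%:Z.
Hypothesis H2 : assumption2 a alpha1 alpha2.
Hypothesis V0 : 0 < V.
Local Notation K := (8 * A)%N.
Local Notation kappa := (smoothing_cst alpha1 alpha2).

Lemma dTV_le : `|dTV (law P W) TP|
  <= 2 / V + 2 * K%:R ^+ 3 * (1 + 5 * kappa) * Num.sqrt n%:R / V.
Proof.
have VE := var_perm_sum rhoP a; move: V0; rewrite VE (mean_perm_sum rhoP) => V0'.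
apply: sup_norm_image_le => B; rewrite (law_perm_sum rhoP).
exact: (dTV_pointwise a10 a20 n0 aA H2 V0').
Qed.

Lemma dloc_le : `|dloc (law P W) TP| <= (2 + 80 * K%:R ^+ 3 * kappa) / V.
Proof.
have VE := var_perm_sum rhoP a; move: V0; rewrite VE (mean_perm_sum rhoP) => V0'.
apply: (sup_norm_image_le (f := fun k => _ - _)) => k; rewrite (law_perm_sum rhoP).
exact: (dloc_pointwise a10 a20 n0 aA H2 V0').
Qed.

End Distances.

(** * Asymptotic rates *)

Local Open Scope classical_set_scope.
Local Open Scope ring_scope.
Unset Implicit Arguments.

Theorem theorem2p10 (R : realType)
    (d : nat -> measure_display) (T : forall n : nat, measurableType (d n))
    (P : forall n : nat, probability (T n) R)
    (rho : forall n : nat, T n -> 'S_n)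
    (hrho : forall n : nat, uniform_permutation (P n) (rho n))
    (a : forall n : nat, 'M[int]_n)
    (A1 alpha0 alpha1 alpha2 : R)
    (hA1 : 0 < A1) (halpha0 : 0 < alpha0)
    (halpha1 : 0 < alpha1) (halpha2 : 0 < alpha2) :
  let W (n : nat) : T n -> int := fun w => perm_sum (a n) (rho n w) in
  let sigma (n : nat) : R := Num.sqrt (var (P n) (W n)) in
  let TP (n : nat) : set int -> \bar R :=
    translated_poisson (mean (P n) (W n)) (var (P n) (W n)) in
  (\forall n \near \oo, assumption1 (a n) (sigma n ^+ 2) A1 alpha0 /\
                        assumption2 (a n) alpha1 alpha2) ->
  (fun n : nat => dTV (law (P n) (W n)) (TP n)) =O_\oo
    (fun n : nat => (sigma n)^-1) /\
  (fun n : nat => dloc (law (P n) (W n)) (TP n)) =O_\oo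
    (fun n : nat => Num.sqrt (ln (sigma n)) / sigma n ^+ 2).
Proof.
move=> W sigma TP Hyp.
pose w := alpha0 * A1; have w0 : 0 < w by rewrite mulr_gt0.
(* Integer entries bounded by [A1] are bounded by its floor. *)
pose A := `|Num.floor A1|%N.
pose C1 : R := 2 * (8 * A)%:R ^+ 3 * (1 + 5 * smoothing_cst alpha1 alpha2).
pose C2 : R := 2 + 80 * (8 * A)%:R ^+ 3 * smoothing_cst alpha1 alpha2.
have kappa0 := smoothing_cst_ge0 halpha1 halpha2.
have C10 : 0 <= C1.
  by apply: mulr_ge0; [rewrite mulr_ge0 ?exprn_ge0|rewrite addr_ge0// mulr_ge0].
have C20 : 0 < C2 by rewrite /C2 ltr_wpDr// mulr_ge0// mulr_ge0// exprn_ge0.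
have bounds n : assumption1 (a n) (sigma n ^+ 2) A1 alpha0 ->
    assumption2 (a n) alpha1 alpha2 ->
    [/\ w * Num.sqrt n%:R <= sigma n, (0 < n)%N,
      `|dTV (law (P n) (W n)) (TP n)| <= 2 / sigma n ^+ 2 + C1 * Num.sqrt n%:R / sigma n ^+ 2 &
      `|dloc (law (P n) (W n)) (TP n)| <= C2 / sigma n ^+ 2].
  move=> [aA1 aV] H2.
  have n0 : (0 < n)%N.
    (* For n = 0 the inverse is 0, contradicting the positive lower bound on the variance. *)
    by case: (posnP n) aV => // -> ; rewrite invr0 mul0r leNgt exprn_gt0.
  have nR : 0 < n%:R :> R by rewrite ltr0n.
  have var0 : 0 <= var (P n) (W n).
    by rewrite (var_perm_sum (hrho n)); apply: pmean_ge0 => s; exact: sqr_ge0.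
  have sE : sigma n ^+ 2 = var (P n) (W n) by rewrite sqr_sqrtr.
  have wV : w ^+ 2 * n%:R <= var (P n) (W n).
    by move: aV; rewrite sE [n%:R^-1 * _]mulrC ler_pdivlMr.
  have V0 : 0 < var (P n) (W n) by apply: lt_le_trans wV; rewrite mulr_gt0 ?exprn_gt0.
  have aA i j : `|a n i j| <= A%:Z.
    by rewrite /A gez0_abs ?floor_ge_int ?(ltW hA1)//; exact: aA1.
  split => //; last 2 first.
  - by rewrite sE; apply: (dTV_le (hrho n)).
  - by rewrite sE; apply: (dloc_le (hrho n)).
  rewrite -[w]ger0_norm ?(ltW w0)// -sqrtr_sqr -sqrtrM ?sqr_ge0//.
  by rewrite ler_sqrt.
split; apply/eqO_exP.
  (* Both 1 and sqrt n are at most sigma / w, which trades one factor of 1/sigma^2 for 1/sigma. *)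
  exists ((2 / w + C1 / w)); first by rewrite ltr_wpDr ?divr_ge0 ?divr_gt0 ?(ltW w0).
  near=> n.
  have [h1 h2] : assumption1 (a n) (sigma n ^+ 2) A1 alpha0 /\ assumption2 (a n) alpha1 alpha2.
    by near: n.
  have [ws n0 H _] := bounds n h1 h2; apply: le_trans H _.
  have s1 : 1 <= Num.sqrt n%:R :> R by rewrite -[leLHS]sqrtr1 ler_sqrt ?ler1n.
  have s0 : 0 < sigma n by apply: lt_le_trans ws; rewrite mulr_gt0// (lt_le_trans ltr01).
  rewrite normfV (ger0_norm (ltW s0)).
  have r1 : Num.sqrt n%:R <= sigma n / w by rewrite ler_pdivlMr// mulrC.
  have -> : (2 / w + C1 / w) * (sigma n)^-1 = (2 + C1) * (sigma n / w) / sigma n ^+ 2.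
    by field; rewrite !gt_eqF.
  rewrite -mulrDl ler_wpM2r ?invr_ge0 ?sqr_ge0// mulrDl lerD//.
    by rewrite -{1}[2]mulr1 ler_wpM2l// (le_trans s1).
  by rewrite ler_wpM2l.
exists C2 => //.
near=> n.
have [h1 h2] : assumption1 (a n) (sigma n ^+ 2) A1 alpha0 /\ assumption2 (a n) alpha1 alpha2.
  by near: n.
have [ws n0 _ H] := bounds n h1 h2; apply: le_trans H _.
(* Once sigma is at least e, the factor sqrt(ln sigma) is at least 1, so the bound C2/sigma^2 is
   enough. *)
have es : expR 1 <= sigma n.
  apply: le_trans ws; rewrite mulrC -ler_pdivrMr//.
  rewrite -[_ / _]ger0_norm ?divr_ge0 ?expR_ge0 ?(ltW w0)// -sqrtr_sqr ler_sqrt//.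
  by near: n; exact: nbhs_infty_ger.
have s0 : 0 < sigma n by apply: lt_le_trans es; exact: expR_gt0.
have ln1 : 1 <= Num.sqrt (ln (sigma n)).
  rewrite -[leLHS]sqrtr1 ler_sqrt; first by rewrite -[1]expRK ler_ln ?posrE ?expR_gt0.
  by rewrite ln_ge0// (le_trans _ es)// -expR0 ler_expR.
rewrite ger0_norm ?divr_ge0 ?sqrtr_ge0 ?sqr_ge0// mulrA.
by rewrite ler_wpM2r ?invr_ge0 ?sqr_ge0// -[leLHS]mulr1 ler_wpM2l ?(ltW C20).
Unshelve. all: by end_near.
Qed.
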